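(* For any valid pair $(\mu,\nu)$ such that $\mu$ has finite support, almost surely infinitely many bullets survive (in the process on the full sequence $(b_0,b_1,\dots)$), and all but finitely many survivors have velocity $v_c(\mu,\nu)$.
   Context: Bullet process. Let $\mu$ (velocity distribution) and $\nu$ (delay distribution) be probability measures on $(0,\infty)$, and let $(v_i,\Delta_i)_{i\ge 0}$ be i.i.d. with law $\mu\otimes\nu$. Bullet $b_i=(i,v_i,\Delta_i)$ has index $i$, velocity $v_i$ and delay $\Delta_i$. Given bullets $(b_i)_{i\in J}$ indexed by a finite or infinite set $J=\{m,m+1,\dots\}$ of consecutive nonnegative integers, the bullet process on them is defined as follows: $b_i$ is fired from the origin at time $t_i=\sum_{m<j\le i}\Delta_j$ (so the first bullet is fired at time $0$) and its trajectory is $d_t(i)=v_i(t-t_i)$ for $t\ge t_i$. It becomes active at time $t_i$ and remains active until the first time, if ever, it collides with (is at the same position as) another active bullet; colliding bullets annihilate and are inactive at all later times. A bullet perishes in the process if it is annihilated, and otherwise survives in it. The pair $(\mu,\nu)$ is valid if almost surely no three bullets collide simultaneously. This is assumed throughout. Let $b_0^v=(0,v,\Delta_0)$ for $v\ge 0$ (velocity $0$ is allowed here), and let $\theta(v)$ be the probability that $b_0^v$ survives in the process on $(b_0^v,b_1,b_2,\dots)$. The critical velocity is $v_c=v_c(\mu,\nu)=\inf\{v\ge 0:\theta(v)>0\}\in[0,\infty]$ (with $\inf\varnothing=\infty$). *)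

(* Defs.v *)
(* MathComp / MathComp-Analysis *)
From HB Require Import structures.
From mathcomp Require Import all_boot all_order all_algebra.
From mathcomp Require Import all_classical all_reals all_analysis.

Set Implicit Arguments.
Unset Strict Implicit.
Unset Printing Implicit Defensive.

Import Order.TTheory GRing.Theory Num.Theory.
Import numFieldNormedType.Exports.

Local Open Scope classical_set_scope.
Local Open Scope ring_scope.

(* The deterministic dynamics. A configuration b : nat -> R * R gives the
   velocity (b i).1 and the delay (b i).2 of the i-th bullet. *)
Section dynamics.
Context {R : realType}.
Implicit Types (b : nat -> R * R) (A : R -> set nat) (t : R) (i : nat).

(* The delay of bullet 0 is not used: bullet 0 is fired at time 0. *)
Definition fire_time b i : R := \sum_(1 <= j < i.+1) (b j).2.

Definition position b t i : R := (b i).1 * (t - fire_time b i).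

(* A t is the set of bullets active at time t. The bullets that collide at
   time t still belong to A t; they are inactive at all later times. *)
Definition collides b A t i : Prop :=
  A t i /\ exists j, [/\ j <> i, A t j & position b t j = position b t i].

Definition is_bullet_process b A : Prop :=
  forall t i, A t i <->
    fire_time b i <= t /\ forall s, s < t -> ~ collides b A s i.

(* There is exactly one A satisfying is_bullet_process b A as soon as the
   velocities and delays are positive (bullet 0 may have velocity 0) and the
   firing times tend to infinity; the choice made by get only matters outside
   of this event, which is almost sure for i.i.d. positive delays. *)
Definition active b : R -> set nat := get [set A | is_bullet_process b A].

Definition perishes b i : Prop := exists t, collides b (active b) t i.

Definition survives b i : Prop := ~ perishes b i.

Definition triple_collision b : Prop :=
  exists t i j k, [/\ i <> j, j <> k & i <> k] /\
    [/\ active b t i, active b t j & active b t k] /\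
    position b t i = position b t j /\ position b t j = position b t k.

Definition set_velocity0 b (w : R) : nat -> R * R :=
  fun i => if i == 0%N then (w, (b 0%N).2) else b i.

End dynamics.

Section random_bullets.
Context {R : realType}.

Definition msupport (mu : probability (measurableTypeR R) R) : set R :=
  [set x | forall U : set R, open U -> U x -> (0 < mu U)%E].

Context d (T : measurableType d) (P : probability T R).

Definition mutually_independent d' (T' : measurableType d')
    (X : nat -> {RV P >-> T'}) : Prop :=
  forall (J : seq nat) (B : nat -> set T'), uniq J ->
    (forall i, measurable (B i)) ->
    P (\big[setI/setT]_(i <- J) (X i @^-1` B i)) =
    (\prod_(i <- J) P (X i @^-1` B i))%E.

Definition iid_bullets (mu nu : probability (measurableTypeR R) R)
    (X : nat -> {RV P >-> (measurableTypeR R * measurableTypeR R)%type}) :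
    Prop :=
  mutually_independent X /\
  forall i B, measurable B -> distribution P (X i) B = (mu \x nu)%E B.

Variable X : nat -> {RV P >-> (measurableTypeR R * measurableTypeR R)%type}.

Definition config (x : T) : nat -> R * R := fun i => X i x.

Definition valid : Prop := {ae P, forall x, ~ triple_collision (config x)}.

(* The outer measure P^* is the probability for the completion of P: it agrees
   with P on measurable events, and the survival event is only guaranteed to be
   measurable up to the null event on which the process is not well defined. *)
Definition theta (w : R) : \bar R :=
  (P^*)%mu [set x | survives (set_velocity0 (config x) w) 0%N].

Definition critical_velocity : \bar R :=
  ereal_inf [set w%:E | w in [set w : R | 0 <= w /\ (0 < theta w)%E]].

End random_bullets.

(* Main.v *)
Require Import Defs.
From mathcomp Require Import all_boot all_order all_algebra.
From mathcomp Require Import all_classical all_reals all_analysis.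
From mathcomp Require Import measurable_realfun ring lra.
Import Order.TTheory GRing.Theory Num.Theory.
Import numFieldNormedType.Exports.
Local Open Scope classical_set_scope.
Local Open Scope ring_scope.

Set Implicit Arguments.
Unset Strict Implicit.
Unset Printing Implicit Defensive.

(** Let V be the finite support of the velocity law and let s be the least
    element of V with theta s > 0; such an s exists because nothing is faster
    than max V, so theta (max V) = 1. The proof shows that s-bullets survive
    infinitely often, that all but finitely many survivors have velocity s, and
    finally that s is the critical velocity.

    Deterministic facts. Active bullets stay in firing order, so the trajectory
    of a surviving bullet is a wall that separates the bullets fired before it
    from those fired after it. Hence bullet i survives if and only if it survives
    in the process on [0, i] and in the process on [i, oo) ([immortal_glue],
    [immortal_upto], [immortal_from]), and survivors have nonincreasing velocities.
    A bullet of velocity x that survives in [i, oo) is a ghost of velocity x not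
    hit by the bullets fired after it, so velocities with theta x = 0 never
    survive: all survivors have velocity at least s.

    Launching. Call index n clear when bullet n, with velocity at least s,
    survives in [0, n] (if s = min V, every n is clear). A next bullet of velocity
    s then survives in [0, n + 1], being shielded by bullet n or slower than all
    others, and so survives
    for ever as soon as it survives in [n + 1, oo). Given the bullets up to n this
    has the fixed probability mu {s} * theta s > 0. Therefore infinitely many clear
    indices force infinitely many s-survivors, by a Levy zero-one argument
    ([trials], [clear_often_negligible]).

    Finding clear indices. If s > min V let w be the element of V just below s, so
    theta w = 0. A pair of a slowest bullet followed by a fastest one annihilates
    without disturbing anything else; putting many such pairs behind a w-ghost
    gives it an arbitrarily large lead with positive probability. Thus theta w = 0
    implies that almost surely every line of velocity w is hit, whatever its lead
    ([unhit_negligible]). The first bullet to hit such a line makes its index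
    clear ([first_hitter]). Letting the lead tend to infinity, either infinitely
    many indices are clear or one and the same bullet hits lines of arbitrarily
    large lead, hence survives with velocity at least s ([late_hitters]).

    Conclusion. By stationarity all this holds for every shifted sequence. Each
    shift has a survivor of velocity at least s; chaining them through the wall
    property gives infinitely many survivors of velocity at least s, hence
    infinitely many clear indices, hence infinitely many s-survivors
    ([survivors_almost_surely]). For w < s an s-survivor hits the w-ghost, so
    theta w = 0, and the infimum defining the critical velocity is s. *)

(** * Existence and uniqueness of the process on a set of bullets *)

Section dynamics.
Context {R : realType}.
Implicit Types (b : nat -> R * R) (A : R -> set nat) (J : set nat).

(** Bullet 0 may have velocity 0, since ghosts are allowed to stand still. *)
Definition regular b : Prop :=
  [/\ 0 <= (b 0%N).1, forall i, 0 < (b i.+1).1, forall i, 0 < (b i.+1).2 &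
      forall M, exists i, M < fire_time b i].

(** The dynamics of the bullets of J alone, on the clock of the full sequence:
    bullets outside J are deleted without changing the firing times of the others. *)
Definition is_process b J A : Prop :=
  forall t i, A t i <->
    [/\ J i, fire_time b i <= t & forall s, s < t -> ~ collides b A s i].

Definition meeting_time b (i j : nat) : R :=
  ((b j).1 * fire_time b j - (b i).1 * fire_time b i) / ((b j).1 - (b i).1).

Lemma fire_time0 b : fire_time b 0 = 0.
Proof. by rewrite /fire_time big_geq. Qed.

Lemma fire_timeS b i : fire_time b i.+1 = fire_time b i + (b i.+1).2.
Proof. by rewrite /fire_time big_nat_recr. Qed.

Lemma fire_time_lt b i j : regular b -> (i < j)%N ->
  fire_time b i < fire_time b j.
Proof.
move=> [_ _ dpos _]; elim: j => // j IH; rewrite ltnS fire_timeS leq_eqVlt.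
move=> /orP[/eqP ->|/IH]; first by rewrite ltrDl.
by move=> /lt_le_trans; apply; rewrite lerDl ltW.
Qed.

Lemma fire_time_le b i j : regular b -> (i <= j)%N ->
  fire_time b i <= fire_time b j.
Proof.
move=> rb; rewrite leq_eqVlt => /orP[/eqP ->//|ij].
exact/ltW/fire_time_lt.
Qed.

Lemma velocity_ge0 b i : regular b -> 0 <= (b i).1.
Proof. by case=> v0 vS _ _; case: i => // i; exact/ltW. Qed.

Lemma velocity_gt0 b i : regular b -> (0 < i)%N -> 0 < (b i).1.
Proof. by case=> v0 vS _ _; case: i. Qed.

(** Two bullets with equal velocities run on distinct parallel lines; this uses that
    at most one of them, bullet 0, can be at rest. *)
Lemma meeting_timeP b i j s : regular b -> i <> j ->
  position b s i = position b s j ->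
  (b i).1 != (b j).1 /\ s = meeting_time b i j.
Proof.
move=> rb ij; rewrite /position => e.
have nv : (b i).1 != (b j).1.
  apply/eqP => vv; move: e; rewrite vv => e.
  have v0 : (b j).1 != 0.
    case: (posnP j) => [j0|/(velocity_gt0 rb)/lt0r_neq0//].
    rewrite -vv lt0r_neq0// velocity_gt0// lt0n; apply/eqP => i0.
    by apply: ij; rewrite i0 j0.
  have /orP[] : (i < j)%N || (j < i)%N by rewrite -neq_ltn; apply/eqP.
  - by move=> /(fire_time_lt rb); have := mulfI v0 e; lra.
  - by move=> /(fire_time_lt rb); have := mulfI v0 e; lra.
split => //; rewrite /meeting_time.
have d0 : (b j).1 - (b i).1 != 0 by rewrite subr_eq0 eq_sym.
apply: (mulIf d0); rewrite divfK //; lra.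
Qed.

Definition meets b i j s : Prop :=
  [/\ i <> j, fire_time b i <= s, fire_time b j <= s &
      position b s i = position b s j].

(** Before a fixed time only finitely many bullets are fired, so meetings of
    trajectories occur at finitely many times. Counting the pairs that met before t
    gives a rank, which turns well-founded recursion on meeting times into recursion
    on natural numbers. *)
Lemma meeting_rank b T : regular b -> exists c : R -> nat,
  (forall s t, s <= t -> t <= T -> (c s <= c t)%N) /\
  (forall s t i j, s < t -> t <= T -> meets b i j s -> (c s < c t)%N).
Proof.
move=> rb; have [_ _ _ /(_ T) [K TK]] := rb.
pose S t := [set p : 'I_K * 'I_K | `[< exists2 s, s < t & meets b p.1 p.2 s >]]%SET.
exists (fun t => #|S t|); split.
  move=> s t st tT; apply: subset_leq_card; apply/fintype.subsetP => p.
  rewrite !finset.in_set => /asboolP[u us m]; apply/asboolP; exists u => //.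
  exact: lt_le_trans st.
move=> s t i j st tT m; have [ij is_ js e] := m.
have lK k : fire_time b k <= s -> (k < K)%N.
  move=> ks; rewrite ltnNge; apply/negP => /(fire_time_le rb); lra.
pose p := (Ordinal (lK i is_), Ordinal (lK j js)).
apply: proper_card; apply/properP; split.
  apply/fintype.subsetP => q.
  rewrite !finset.in_set => /asboolP[u us mq]; apply/asboolP; exists u => //.
  exact: lt_trans st.
(* The pair that meets at s is counted at t but not at s. *)
exists p; rewrite finset.in_set; first by apply/asboolP; exists s.
apply/asboolP => -[u us [/= _ _ _ e']].
have [_ se] := meeting_timeP rb ij e.
have [_ ue] := meeting_timeP rb ij e'.
by move: us; rewrite se ue ltxx.
Qed.

Lemma meeting_ind b (Q : R -> Prop) : regular b ->
  (forall t, (forall s i j, s < t -> meets b i j s -> Q s) -> Q t) ->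
  forall t, Q t.
Proof.
move=> rb IH T; have [c [_ clt]] := meeting_rank T rb.
suff H n t : t <= T -> (c t <= n)%N -> Q t by exact: (H (c T)).
elim: n t => [|n IHn] t tT ct; apply: IH => s i j st m; have := clt _ _ _ _ st tT m.
- by move=> /leq_trans /(_ ct).
- by move=> /leq_trans /(_ ct); rewrite ltnS; apply: IHn; lra.
Qed.

Lemma process_fired b J A t i : is_process b J A -> A t i ->
  J i /\ fire_time b i <= t.
Proof. by move=> pA /pA[]. Qed.

Lemma process_down b J A s t i : is_process b J A -> A t i ->
  fire_time b i <= s -> s <= t -> A s i.
Proof.
move=> pA /pA[Ji _ h] is_ st; apply/pA; split => // u us; apply: h.
exact: lt_le_trans st.
Qed.

Lemma process_meets b J A t i j : is_process b J A ->
  A t i -> A t j -> j <> i -> position b t j = position b t i -> meets b i j t.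
Proof.
by move=> pA /(process_fired pA)[_ ?] /(process_fired pA)[_ ?] ji e; split => // /esym.
Qed.

Lemma process_unique b J A A' : regular b -> is_process b J A ->
  is_process b J A' -> forall t i, A t i <-> A' t i.
Proof.
move=> rb pA pA'; apply: (meeting_ind rb) => t IH i.
have key B B' : is_process b J B -> is_process b J B' ->
    (forall s i j, s < t -> meets b i j s -> forall k, B s k <-> B' s k) ->
    B t i -> B' t i.
  move=> pB pB' E /pB[Ji it h]; apply/pB'; split => // s st [Bi [j [ji Bj e]]].
  have m := process_meets pB' Bi Bj ji e.
  apply: (h s st); split; first by apply/(E _ _ _ st m).
  by exists j; split => //; apply/(E _ _ _ st m).
split; [apply: key => //|apply: key => //] => s k l st m r.
by apply: iff_sym; apply: IH m _.
Qed.

(** Picard iteration for the fixed-point equation of the process. Collisions are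
    tested at the explicit meeting times rather than at all earlier times, so that
    only countably many conditions occur and measurability can be read off. *)
Fixpoint life_iter b J (n : nat) (t : R) : set nat :=
  if n is m.+1 then
    [set i | [/\ J i, fire_time b i <= t & forall j, j <> i ->
       meeting_time b i j < t ->
       position b (meeting_time b i j) j = position b (meeting_time b i j) i ->
       life_iter b J m (meeting_time b i j) i ->
       ~ life_iter b J m (meeting_time b i j) j]]
  else [set i | J i /\ fire_time b i <= t].

(** The iteration stabilizes at each time, after as many steps as there were
    meetings before it; the limit makes sense for every configuration. *)
Definition life b J (t : R) : set nat :=
  [set i | exists N, forall m, (N <= m)%N -> life_iter b J m t i].

Lemma life_iter_fired b J n t i : life_iter b J n t i -> J i /\ fire_time b i <= t.
Proof. by case: n => [|n] /= []. Qed.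

Lemma life_iter_stable b J T (c : R -> nat) : regular b ->
  (forall s t i j, s < t -> t <= T -> meets b i j s -> (c s < c t)%N) ->
  forall n t m m', t <= T -> (c t <= n)%N -> (n <= m)%N -> (n <= m')%N ->
  forall i, life_iter b J m t i -> life_iter b J m' t i.
Proof.
move=> rb clt; elim=> [|n IH] t m m' tT ct nm nm' i lm.
  have [Ji it] := life_iter_fired lm.
  case: m' nm' => [|m'] nm' //=; split => // j ji st e li lj.
  have [_ is_] := life_iter_fired li; have [_ js] := life_iter_fired lj.
  have m0 : meets b i j (meeting_time b i j) by split => // /esym.
  by have := leq_trans (clt _ _ _ _ st tT m0) ct.
case: m nm lm => // m nm [Ji it h]; case: m' nm' => // m' nm'.
split => // j ji st e li lj.
have [_ is_] := life_iter_fired li; have [_ js] := life_iter_fired lj.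
have cs : (c (meeting_time b i j) <= n)%N.
  rewrite -ltnS; apply: leq_trans ct; apply: (clt _ _ i j) => //.
  by split => // /esym.
have sT : meeting_time b i j <= T by lra.
by apply: (h j ji st e); apply: (IH _ _ _ sT cs) lj || apply: (IH _ _ _ sT cs) li.
Qed.

(** Up to time T the iterates agree from rank c T on, so the limit satisfies the
    fixed-point equation because the iterates do. *)
Lemma lifeP b J : regular b -> is_process b J (life b J).
Proof.
move=> rb T i; have [c [cle clt]] := meeting_rank T rb.
have lifeE t m k : t <= T -> (c T <= m)%N -> life b J t k <-> life_iter b J m t k.
  move=> tT cm; have ct := cle _ _ tT (lexx T); split.
    move=> [N /(_ (maxn N m) (leq_maxl _ _))].
    apply: (life_iter_stable rb clt tT ct) => //.
    by rewrite (leq_trans cm)// leq_maxr.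
  move=> lm; exists m => m' mm'; apply: (life_iter_stable rb clt tT ct) lm => //.
  exact: leq_trans mm'.
rewrite (lifeE _ (c T).+1)//=; split => -[Ji iT h]; split => //.
  move=> s sT [li [j [ji lj e]]].
  have [_ se] := meeting_timeP rb (nesym ji) (esym e); subst s.
  apply: (h j ji sT e); apply/lifeE => //; lra.
move=> j ji sT e li lj; apply: (h _ sT); split.
  by apply/lifeE; [lra| |exact: li].
by exists j; split => //; apply/lifeE; [lra| |exact: lj].
Qed.

Lemma lifeE b J A t i : regular b -> is_process b J A -> life b J t i <-> A t i.
Proof. by move=> rb pA; apply: (process_unique rb _ pA); exact: lifeP. Qed.

Lemma activeE b t i : regular b -> active b t i <-> life b setT t i.
Proof.
move=> rb; have spec A : is_bullet_process b A <-> is_process b setT A.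
  split => h t' i'; split.
  - by move=> /h[].
  - by move=> [_ ? ?]; apply/h.
  - by move=> /h[].
  - by move=> [? ?]; apply/h.
have ex : [set A | is_bullet_process b A] (life b setT) by apply/spec; exact: lifeP.
have /spec pa : is_bullet_process b (active b) by exact: (getI ex).
by apply: iff_sym; exact: lifeE.
Qed.

Definition immortal b J i : Prop :=
  J i /\ forall t, fire_time b i <= t -> life b J t i.

Lemma survivesE b i : regular b -> survives b i <-> immortal b setT i.
Proof.
move=> rb; split.
  move=> h; split => // t it; apply/(lifeP _ rb); split => // s st [li [j [ji lj e]]].
  apply: h; exists s; split; first exact/activeE.
  by exists j; split => //; exact/activeE.
move=> [_ h] [s [/activeE li [j [ji /activeE lj e]]]].
have [_ is_] := process_fired (lifeP _ rb) (li rb).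
have : life b setT (s + 1) i by apply: h; lra.
move=> /(lifeP _ rb)[_ _ /(_ s)]; apply; first lra.
by split; [exact: li|exists j; split => //; exact: lj].
Qed.

End dynamics.

(** * Order, separation and survivors *)

Section separation.
Context {R : realType}.
Implicit Types (b : nat -> R * R) (A : R -> set nat) (J : set nat).

Definition upto (n : nat) : set nat := [set i | (i <= n)%N].
Definition from (n : nat) : set nat := [set i | (n <= i)%N].

(** Positions are affine in time, so this replaces the intermediate value theorem. *)
Lemma affine_root (p q s t : R) : s <= t -> p + q * s <= 0 -> 0 <= p + q * t ->
  exists u, [/\ s <= u, u <= t & p + q * u = 0].
Proof.
move=> st fs ft; have [fs0|fs0] := eqVneq (p + q * s) 0; first by exists s.
have fsn : p + q * s < 0 by rewrite lt_neqAle fs0.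
have q0 : 0 < q.
  have d : 0 < q * (t - s) by lra.
  have ts : 0 < t - s.
    by rewrite lt_neqAle subr_ge0 st andbT eq_sym; apply: contraTneq d => ->; rewrite mulr0 ltxx.
  by rewrite -(pmulr_lgt0 _ ts).
exists (- p / q); rewrite ler_pdivlMr// ler_pdivrMr// mulrCA divff ?lt0r_neq0//.
by split; lra.
Qed.

Lemma position_fire b i : position b (fire_time b i) i = 0.
Proof. by rewrite /position subrr mulr0. Qed.

Lemma position_ge0 b t i : regular b -> fire_time b i <= t -> 0 <= position b t i.
Proof. by move=> rb it; rewrite mulr_ge0 ?velocity_ge0// subr_ge0. Qed.

(** To overtake, the later bullet would have to meet the earlier one at a time when
    both are still active, which annihilates them. *)
Lemma process_order b J A t i j : regular b -> is_process b J A -> (i < j)%N ->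
  A t i -> A t j -> position b t j <= position b t i.
Proof.
move=> rb pA ij Ai Aj; rewrite leNgt; apply/negP => lt_ij.
have [_ it] := process_fired pA Ai; have [_ jt] := process_fired pA Aj.
have tij := fire_time_lt rb ij.
pose p := (b i).1 * fire_time b i - (b j).1 * fire_time b j.
pose q := (b j).1 - (b i).1.
have E s : p + q * s = position b s j - position b s i.
  by rewrite /p /q /position; ring.
have [||s [js st]] := @affine_root p q _ _ jt.
- by rewrite E position_fire sub0r oppr_le0 position_ge0// ltW.
- by rewrite E subr_ge0 ltW.
rewrite E => /eqP; rewrite subr_eq0 => /eqP e.
have st' : s < t by rewrite lt_neqAle st andbT; apply: contraTneq lt_ij => <-; rewrite e ltxx.
have /pA[_ _ /(_ s st')] := Ai; apply; split.
  by apply: (process_down pA Ai) => //; lra.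
exists j; split => //; first by move=> ji; rewrite ji ltnn in ij.
exact: (process_down pA Aj).
Qed.

(** Two groups whose active bullets never meet do not notice each other; by
    uniqueness this is how every process on a larger set is computed below. *)
Lemma process_union b J1 J2 A1 A2 : is_process b J1 A1 -> is_process b J2 A2 ->
  (forall t i j, A1 t i -> A2 t j -> position b t i <> position b t j) ->
  is_process b (J1 `|` J2) (fun t => A1 t `|` A2 t).
Proof.
move=> p1 p2 sep t i; split.
- case=> Ai; [have [Ji it] := process_fired p1 Ai|have [Ji it] := process_fired p2 Ai].
  + split => //; first by left.
    move=> s st [Bi [j [ji Bj e]]].
    have is_ : fire_time b i <= s.
      by case: Bi => [/(process_fired p1)|/(process_fired p2)] [].
    have Ai' := process_down p1 Ai is_ (ltW st).
    case: Bj => Aj; last by apply: (sep s i j) => //.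
    by have /p1[_ _ /(_ s st)] := Ai; apply; split => //; exists j.
  + split => //; first by right.
    move=> s st [Bi [j [ji Bj e]]].
    have is_ : fire_time b i <= s.
      by case: Bi => [/(process_fired p1)|/(process_fired p2)] [].
    have Ai' := process_down p2 Ai is_ (ltW st).
    case: Bj => Aj; first by apply: (sep s j i) => //.
    by have /p2[_ _ /(_ s st)] := Ai; apply; split => //; exists j.
- move=> [[Ji|Ji] it h].
  + left; apply/p1; split => // s st [Ai [j [ji Aj e]]]; apply: (h s st).
    by split; [left|exists j; split => //; left].
  + right; apply/p2; split => // s st [Ai [j [ji Aj e]]]; apply: (h s st).
    by split; [right|exists j; split => //; right].
Qed.

Lemma process_restrict b J J' A : is_process b J A -> J' `<=` J ->
  (forall t i j, J' i -> ~ J' j -> A t i -> A t j ->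
     position b t i <> position b t j) ->
  is_process b J' (fun t => A t `&` J').
Proof.
move=> pA JJ sep t i; split.
- move=> [/pA[Ji it h] J'i]; split => // s st [[Ai _] [j [ji [Aj _] e]]].
  by apply: (h s st); split => //; exists j.
- move=> [J'i it h]; split => //; apply/pA; split => //; first exact: JJ.
  move=> s st [Ai [j [ji Aj e]]]; apply: (h s st); split => //.
  have [J'j|nJ'j] := pselect (J' j); first by exists j.
  by exfalso; apply: (sep s i j).
Qed.

(** A meeting would annihilate the bullet that is active at all times. *)
Lemma immortal_apart b J t i j : regular b -> immortal b J i ->
  fire_time b i <= t -> life b J t j -> j <> i ->
  position b t j <> position b t i.
Proof.
move=> rb [Ji h] it lj ji e.
have : life b J (t + 1) i by apply: h; lra.
move=> /(lifeP _ rb)[_ _ /(_ t)]; apply; first lra.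
by split; [exact: h|exists j].
Qed.

Lemma life_remove b J t i a : regular b -> immortal b J i ->
  life b (J `\ i) t a <-> life b J t a /\ a <> i.
Proof.
move=> rb im; have pA := lifeP J rb.
have pR : is_process b (J `\ i) (fun t => life b J t `&` (J `\ i)).
  apply: (process_restrict pA); first by move=> ? [].
  move=> s k j [Jk /= ki] nj lk lj; have [Jj js] := process_fired pA lj.
  have ji : j = i by apply: contrapT => ji; apply: nj.
  by subst j; apply: (immortal_apart rb im).
rewrite (lifeE _ _ rb pR); split => -[la]; first by case.
by split => //; split => //; exact: (process_fired pA la).1.
Qed.

Lemma from_succ i : from i `\ i = from i.+1.
Proof.
apply/seteqP; split => j; rewrite /from /=.
  by move=> [ij /nesym/eqP nij]; rewrite ltn_neqAle nij.
by move=> ij; split; [exact: ltnW|move=> e; rewrite e ltnn in ij].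
Qed.

Lemma upto_from n : upto n `|` from n.+1 = setT.
Proof.
rewrite eqEsubset; split => // j _.
by have [ji|ij] := leqP j n; [left|right].
Qed.

(** In firing order, bullet i is a wall in both processes: bullets before it are
    strictly in front of it, bullets after it strictly behind. *)
Lemma glue b i : regular b -> immortal b (upto i) i -> immortal b (from i) i ->
  forall t a, life b setT t a <-> life b (upto i) t a \/ life b (from i.+1) t a.
Proof.
move=> rb iu ifr t a.
have pU : is_process b (upto i `|` from i.+1)
    (fun t => life b (upto i) t `|` life b (from i.+1) t).
  apply: process_union; [exact: lifeP|exact: lifeP|].
  move=> s k l lk; rewrite -from_succ => /(life_remove _ _ rb ifr)[ll li] e.
  have [kI _] := process_fired (lifeP _ rb) lk.
  have [lI ls] := process_fired (lifeP _ rb) ll.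
  have il : (i < l)%N by rewrite ltn_neqAle lI andbT; apply/eqP => /esym.
  have is_ : fire_time b i <= s by apply: le_trans ls; apply: fire_time_le.
  have := immortal_apart rb ifr is_ ll li.
  have := process_order rb (lifeP _ rb) il (ifr.2 _ is_) ll.
  suff : position b s i <= position b s k by rewrite e; lra.
  have [-> //|/eqP ki] := eqVneq k i.
  apply: (process_order rb (lifeP (upto i) rb)) lk (iu.2 _ is_).
  by rewrite ltn_neqAle kI andbT; apply/eqP.
rewrite upto_from in pU; exact: (lifeE _ _ rb pU).
Qed.

Lemma immortal_glue b i : regular b -> immortal b (upto i) i ->
  immortal b (from i) i -> immortal b setT i.
Proof. by move=> rb iu ifr; split => // t it; apply/(glue rb iu ifr); left; exact: iu.2. Qed.

Lemma immortal_separates b i t j k : regular b -> immortal b setT i ->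
  (j < i)%N -> (i < k)%N -> life b setT t j -> life b setT t k ->
  position b t k < position b t i < position b t j.
Proof.
move=> rb im ji ik lj lk.
have [_ kt] := process_fired (lifeP _ rb) lk.
have it : fire_time b i <= t by apply: le_trans kt; apply/fire_time_le/ltnW.
have li := im.2 _ it.
have pT := lifeP setT rb.
rewrite !lt_neqAle (process_order rb pT ik)// (process_order rb pT ji)// !andbT.
apply/andP; split; apply/eqP.
  by apply: (immortal_apart rb im) => // e; rewrite e ltnn in ik.
by apply/nesym/(immortal_apart rb im) => // e; rewrite e ltnn in ji.
Qed.

(** Survival is not affected by the bullets behind the wall. *)
Lemma immortal_upto b i : regular b -> immortal b setT i -> immortal b (upto i) i.
Proof.
move=> rb im; split; first exact: leqnn.
have pR : is_process b (upto i) (fun t => life b setT t `&` upto i).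
  apply: (process_restrict (lifeP _ rb)) => //.
  move=> t k j; rewrite /upto /= leq_eqVlt => /orP[/eqP ->|ki] /negP; rewrite -ltnNge => ij lk lj e.
    have [_ it] := process_fired (lifeP _ rb) lk.
    by apply: (immortal_apart rb im it lj _ (esym e)) => ji; rewrite ji ltnn in ij.
  by have /andP[] := immortal_separates rb im ki ij lk lj; rewrite e; lra.
move=> t it; apply/(lifeE _ _ rb pR); split; [exact: im.2|exact: leqnn].
Qed.

(** Survival is not affected by the bullets in front of the wall. *)
Lemma immortal_from b i : regular b -> immortal b setT i -> immortal b (from i) i.
Proof.
move=> rb im; split; first exact: leqnn.
have pR : is_process b (from i) (fun t => life b setT t `&` from i).
  apply: (process_restrict (lifeP _ rb)) => //.
  move=> t k j; rewrite /from /= leq_eqVlt => /orP[/eqP <-|ki] /negP; rewrite -ltnNge => ij lk lj e.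
    have [_ it] := process_fired (lifeP _ rb) lk.
    by apply: (immortal_apart rb im it lj _ (esym e)) => ji; rewrite ji ltnn in ij.
  by have /andP[] := immortal_separates rb im ij ki lj lk; rewrite e; lra.
move=> t it; apply/(lifeE _ _ rb pR); split; [exact: im.2|exact: leqnn].
Qed.

(** Behind a survivor the process evolves as if nothing had been fired before it. *)
Lemma immortal_behind b i j : regular b -> immortal b setT i ->
  immortal b (from i.+1) j -> immortal b setT j.
Proof.
move=> rb im [_ jm]; split => // t jt.
by apply/(glue rb (immortal_upto rb im) (immortal_from rb im)); right; exact: jm.
Qed.

Lemma catch_up b i j : regular b -> (i < j)%N -> (b i).1 < (b j).1 ->
  fire_time b j <= meeting_time b i j /\
  position b (meeting_time b i j) j = position b (meeting_time b i j) i.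
Proof.
move=> rb ij vij; set s := meeting_time b i j.
have tij := fire_time_lt rb ij.
have d0 : 0 < (b j).1 - (b i).1 by rewrite subr_gt0.
split.
  rewrite /s /meeting_time ler_pdivlMr//.
  have := ler_wpM2l (velocity_ge0 i rb) (ltW tij); lra.
apply/eqP; rewrite -subr_eq0; apply/eqP.
have -> : position b s j - position b s i = s * ((b j).1 - (b i).1)
   - ((b j).1 * fire_time b j - (b i).1 * fire_time b i) by rewrite /position; ring.
by rewrite /s /meeting_time divfK ?lt0r_neq0// subrr.
Qed.

Lemma immortal_velocity b i j : regular b -> immortal b setT i ->
  immortal b setT j -> (i < j)%N -> (b j).1 <= (b i).1.
Proof.
move=> rb im jm ij; rewrite leNgt; apply/negP => vij.
have [sj e] := catch_up rb ij vij.
apply: (immortal_apart rb im _ (jm.2 _ sj) _ e).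
  by apply: le_trans sj; exact/fire_time_le/ltnW.
by move=> ji; rewrite ji ltnn in ij.
Qed.

End separation.

(** * Lines, ghosts and first hitters *)

Section moving_lines.
Context {R : realType}.
Implicit Types (b : nat -> R * R) (A : R -> set nat) (J : set nat).

Lemma life_iter_congr b b' J : (forall i, J i ->
    fire_time b i = fire_time b' i /\ (b i).1 = (b' i).1) ->
  forall n t i, life_iter b J n t i <-> life_iter b' J n t i.
Proof.
move=> E; elim=> [|n IH] t i /=.
  by split=> -[Ji it]; split => //; move: it; rewrite (E i Ji).1.
have me j : J i -> J j -> meeting_time b' i j = meeting_time b i j.
  by move=> /E[fi vi] /E[fj vj]; rewrite /meeting_time fi fj vi vj.
have pe s k : J k -> position b' s k = position b s k.
  by move=> Jk; rewrite /position -(E k Jk).1 -(E k Jk).2.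
split => -[Ji it h]; (split => //; first by move: it; rewrite (E i Ji).1).
  move=> j ji st e li lj; have [Jj _] := life_iter_fired lj.
  rewrite me// in st e li lj; rewrite !pe// in e.
  by apply: (h j ji st e); exact/IH.
move=> j ji st e li lj; have [Jj _] := life_iter_fired lj.
rewrite -me// in st e li lj; rewrite -!pe// in e.
by apply: (h j ji st e); exact/IH.
Qed.

Lemma life_congr b b' J : (forall i, J i ->
    fire_time b i = fire_time b' i /\ (b i).1 = (b' i).1) ->
  forall t i, life b J t i <-> life b' J t i.
Proof.
move=> E t i; split => -[N h]; exists N => m /h lm.
  exact/(life_iter_congr E).
exact/(life_iter_congr E).
Qed.

(** Adding one bullet that no active bullet meets; used for ghosts and for a bullet
    fired last. *)
Lemma process_add b J A i : is_process b J A ->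
  (forall t j, A t j -> fire_time b i <= t -> position b t j <> position b t i) ->
  is_process b (J `|` [set i]) (fun t => A t `|` [set k | k = i /\ fire_time b i <= t]).
Proof.
move=> pA sep; apply: process_union => //; last first.
  by move=> t j _ Aj [-> it]; exact: sep.
move=> t k; split; last by move=> [/= -> it _].
by move=> /= [-> it]; split => // s _ [_ [j [ji [ji' _] _]]].
Qed.

Lemma immortal_add b J A i : regular b -> is_process b J A ->
  (forall t j, A t j -> fire_time b i <= t -> position b t j <> position b t i) ->
  immortal b (J `|` [set i]) i.
Proof.
move=> rb pA sep; split; first by right.
by move=> t it; apply/(lifeE _ _ rb (process_add pA sep)); right.
Qed.

Lemma upto_succ n : upto n `|` [set n.+1] = upto n.+1.
Proof.
rewrite eqEsubset; split => j; rewrite /upto /=; first by move=> [/leqW|->].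
by rewrite leq_eqVlt => /orP[/eqP ->|]; [right|left].
Qed.

(** Bullet n stays strictly between its slower successor and all earlier bullets. *)
Lemma immortal_slower b n : regular b -> immortal b (upto n) n ->
  (b n.+1).1 <= (b n).1 -> immortal b (upto n.+1) n.+1.
Proof.
move=> rb im vle; rewrite -upto_succ.
apply: (immortal_add rb (lifeP _ rb)) => t j lj nt e.
have [jn jt] := process_fired (lifeP _ rb) lj.
have tn := fire_time_lt rb (ltnSn n).
have ln : life b (upto n) t n by apply: im.2; lra.
have le_nj : position b t n <= position b t j.
  have [-> //|/eqP ki] := eqVneq j n.
  apply: (process_order rb (lifeP (upto n) rb)) lj ln.
  by rewrite ltn_neqAle jn andbT; apply/eqP.
have v0 : 0 < (b n.+1).1 by apply: velocity_gt0.
move: le_nj; rewrite e /position.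
have := ler_wpM2r (_ : 0 <= t - fire_time b n.+1) vle; rewrite subr_ge0 => /(_ nt).
have : 0 < (b n).1 * (fire_time b n.+1 - fire_time b n).
  by rewrite mulr_gt0//; lra.
lra.
Qed.

Lemma immortal_slowest b n : regular b -> (forall i, (b n.+1).1 <= (b i).1) ->
  immortal b (upto n.+1) n.+1.
Proof.
move=> rb vle; rewrite -upto_succ.
apply: (immortal_add rb (lifeP _ rb)) => t j lj nt e.
have [jn jt] := process_fired (lifeP _ rb) lj.
have tn : fire_time b j < fire_time b n.+1 by apply: fire_time_lt.
have v0 : 0 < (b n.+1).1 by apply: velocity_gt0.
have := ler_wpM2r (_ : 0 <= t - fire_time b j) (vle j); rewrite subr_ge0 => /(_ jt).
have : 0 < (b n.+1).1 * (fire_time b n.+1 - fire_time b j).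
  by rewrite mulr_gt0//; lra.
move: e; rewrite /position; lra.
Qed.

Definition shift (m : nat) b : nat -> R * R := fun i => b (m + i)%N.

Lemma fire_time_shift m b i :
  fire_time (shift m b) i = fire_time b (m + i)%N - fire_time b m.
Proof.
elim: i => [|i IH]; first by rewrite fire_time0 addn0 subrr.
by rewrite fire_timeS IH addnS fire_timeS /shift addnS; lra.
Qed.

Lemma regular_shift m b : regular b -> regular (shift m b).
Proof.
move=> rb; have [v0 vS dS ub] := rb; split.
- exact: (velocity_ge0 _ rb).
- by move=> i; apply: (velocity_gt0 rb); rewrite addnS.
- by move=> i; rewrite /shift addnS.
- move=> M; have [i Mi] := ub (M + fire_time b m); exists i.
  rewrite fire_time_shift; have := fire_time_le rb (leq_addl m i); lra.
Qed.

Lemma position_shift m b t i :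
  position (shift m b) t i = position b (t + fire_time b m) (m + i)%N.
Proof. by rewrite /position fire_time_shift /shift; congr (_ * _); lra. Qed.

Lemma life_shift m b t i : regular b ->
  life (shift m b) setT t i <-> life b (from m) (t + fire_time b m) (m + i)%N.
Proof.
move=> rb; have pA := lifeP (from m) rb.
apply: (lifeE (A := fun t i => life b (from m) (t + fire_time b m) (m + i)%N)).
  exact: regular_shift.
move=> {}t {}i; split.
  move=> /pA[_ it h]; split => //; first by rewrite fire_time_shift; lra.
  move=> s st [li [j [ji lj]]]; rewrite !position_shift => e.
  apply: (h (s + fire_time b m)); first lra.
  by split => //; exists (m + j)%N; split => // /addnI.
move=> [_ it h]; apply/pA; split.
- exact: leq_addr.
- by move: it; rewrite fire_time_shift; lra.
move=> s st [li [j [ji lj e]]]; have [mj _] := process_fired pA lj.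
apply: (h (s - fire_time b m)); first lra.
split; first by rewrite subrK.
exists (j - m)%N; rewrite !position_shift !subrK subnKC//; split => //.
by move=> jmi; apply: ji; rewrite -jmi subnKC.
Qed.

Lemma immortal_shift m b i : regular b ->
  immortal (shift m b) setT i <-> immortal b (from m) (m + i)%N.
Proof.
move=> rb; split => -[_ h]; split => //.
- exact: leq_addr.
- move=> t it; have := h (t - fire_time b m); rewrite (life_shift _ _ _ rb) subrK.
  by apply; rewrite fire_time_shift; lra.
- move=> t it; apply/(life_shift _ _ _ rb); apply: h.
  by move: it; rewrite fire_time_shift; lra.
Qed.

(** The line is the trajectory of a ghost of velocity w fired y time units before
    bullet 0; it does not interact with the bullets. *)
Definition nohit b (w y : R) : Prop :=
  forall t j, life b setT t j -> position b t j <> w * (t + y).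

(** A bullet starts behind the line, so to be beyond it now it has crossed it. *)
Lemma crosses b (w y t : R) j : regular b -> 0 <= w -> 0 <= y ->
  life b setT t j -> w * (t + y) <= position b t j ->
  exists s, [/\ s <= t, life b setT s j & position b s j = w * (s + y)].
Proof.
move=> rb w0 y0 lj le_w; have [_ jt] := process_fired (lifeP _ rb) lj.
pose p := - ((b j).1 * fire_time b j) - w * y.
pose q := (b j).1 - w.
have E s : p + q * s = position b s j - w * (s + y).
  by rewrite /p /q /position; ring.
have [||s [js st]] := @affine_root _ p q _ _ jt.
- rewrite E position_fire sub0r oppr_le0 mulr_ge0// addr_ge0//.
  by rewrite -(fire_time0 b) fire_time_le.
- by rewrite E subr_ge0.
rewrite E => /eqP; rewrite subr_eq0 => /eqP e.
by exists s; split => //; apply: (process_down (lifeP _ rb) lj).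
Qed.

Lemma nohit_le b (w y y' : R) : regular b -> 0 <= w -> 0 <= y -> y <= y' ->
  nohit b w y -> nohit b w y'.
Proof.
move=> rb w0 y0 yy h t j lj e.
have [|s [_ ls es]] := crosses rb w0 y0 lj; last exact: h es.
rewrite e; apply: ler_wpM2l => //; lra.
Qed.

Lemma regular_set_velocity0 b (w : R) : regular b -> 0 <= w -> regular (set_velocity0 b w).
Proof.
move=> [v0 vS dS ub] w0; split => // M; have [i Mi] := ub M; exists i.
apply: (lt_le_trans Mi); rewrite /fire_time; apply: ler_sum_nat => j /andP[j0 _].
by rewrite /set_velocity0 gtn_eqF.
Qed.

Lemma fire_time_set_velocity0 b (w : R) i : fire_time (set_velocity0 b w) i = fire_time b i.
Proof.
by apply: eq_big_nat => j /andP[j0 _]; rewrite /set_velocity0 gtn_eqF.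
Qed.

(** Up to its first meeting the ghost has no influence on the bullets behind it, so
    it survives exactly when its line is not met by the process without it. *)
Lemma ghostE b (w : R) : regular b -> 0 <= w ->
  survives (set_velocity0 b w) 0 <-> nohit (shift 1 b) w (b 1%N).2.
Proof.
move=> rb w0; have rg := regular_set_velocity0 rb w0.
set g := set_velocity0 b w in rg *.
have lE t i : life g (from 1) t i <-> life b (from 1) t i.
  apply: life_congr => -[|j] // _; split => //; exact: fire_time_set_velocity0.
have f1 : fire_time b 1 = (b 1%N).2 by rewrite fire_timeS fire_time0 add0r.
have p0 t : position g t 0 = w * t by rewrite /position fire_time0 subr0.
have pS t j : position g t j.+1 = position b t j.+1.
  by rewrite /position fire_time_set_velocity0.
have E : nohit (shift 1 b) w (b 1%N).2 <->
    forall t j, life g (from 1) t j -> position g t j <> position g t 0.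
  split => [h t [|j] lj|h t j /(life_shift _ _ _ rb) lj].
  - by have [] := process_fired (lifeP _ rg) lj.
  - rewrite p0 pS; have := h (t - fire_time b 1) j.
    rewrite (life_shift _ _ _ rb) position_shift subrK -f1 subrK; apply.
    exact/lE.
  - rewrite position_shift -f1 -p0 -pS; exact/h/lE.
rewrite (survivesE _ rg) E; split.
  move=> im t j; have -> : from 1 = setT `\ 0%N.
    rewrite -(from_succ 0); congr (_ `\ _); rewrite eqEsubset; split => //.
  move=> /(life_remove _ _ rg im)[lj j0]; apply: (immortal_apart rg im) => //.
  have [_] := process_fired (lifeP _ rg) lj; apply: le_trans; exact: fire_time_le.
move=> h; have -> : setT = from 1 `|` [set 0%N].
  by rewrite eqEsubset; split => // -[|i] _; [right|left].
apply: (immortal_add rg (lifeP _ rg)) => t j lj _; exact: h.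
Qed.

Lemma nohit_fastest b (w y : R) : regular b -> 0 < w -> 0 < y ->
  (forall i, (b i).1 <= w) -> nohit b w y.
Proof.
move=> rb w0 y0 vle t j lj; have [_ jt] := process_fired (lifeP _ rb) lj.
have : 0 <= fire_time b j by rewrite -(fire_time0 b) fire_time_le.
move=> /(mulr_ge0 (ltW w0)); have := mulr_gt0 w0 y0.
have := ler_wpM2r (_ : 0 <= t - fire_time b j) (vle j); rewrite subr_ge0 => /(_ jt).
rewrite /position; lra.
Qed.

(** A faster bullet that is never annihilated eventually catches up with the line. *)
Lemma hit_of_immortal b (w y : R) i : regular b -> 0 <= w -> 0 <= y -> w < (b i).1 ->
  immortal b setT i -> ~ nohit b w y.
Proof.
move=> rb w0 y0 vw im h.
pose t := ((b i).1 * fire_time b i + w * y) / ((b i).1 - w).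
have d0 : 0 < (b i).1 - w by rewrite subr_gt0.
have it : fire_time b i <= t.
  rewrite ler_pdivlMr//; have := mulr_ge0 w0 y0.
  have : 0 <= w * fire_time b i.
    by rewrite mulr_ge0// -(fire_time0 b) fire_time_le.
  lra.
apply: (h t i (im.2 _ it)); apply/eqP; rewrite -subr_eq0; apply/eqP.
have -> : position b t i - w * (t + y) = t * ((b i).1 - w)
     - ((b i).1 * fire_time b i + w * y) by rewrite /position; ring.
by rewrite /t divfK ?lt0r_neq0// subrr.
Qed.

(** Whoever reaches the line first has nobody in front of it any more, and the
    bullets in front annihilated each other before. So it has met nobody even when
    all later bullets are deleted. *)
Lemma first_hitter b (w y : R) : regular b -> 0 < w -> 0 < y -> ~ nohit b w y ->
  exists t j, [/\ life b setT t j, position b t j = w * (t + y),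
                 immortal b (upto j) j & w < (b j).1].
Proof.
move=> rb w0 y0 /existsNP[t0 /existsNP[j0 /not_implyP[lj0 /contrapT ej0]]].
pose Q j := `[< exists2 t, life b setT t j & position b t j = w * (t + y) >].
have exQ : exists j, Q j by exists j0; apply/asboolP; exists t0.
(* The hitter of least index works as well as the earliest one, and is found
   without comparing hitting times. *)
case: (ex_minnP exQ) => j /asboolP[T lj ej] jmin; exists T, j.
have pL := lifeP setT rb.
have [_ jT] := process_fired pL lj.
have fire0 : 0 <= fire_time b j by rewrite -(fire_time0 b) fire_time_le.
have front a : (a < j)%N -> ~ life b setT T a.
  move=> aj la; have := process_order rb pL aj la lj; rewrite ej => le_w.
  have [s [_ ls es]] := crosses rb (ltW w0) (ltW y0) la le_w.
  have /jmin : Q a by apply/asboolP; exists s.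
  by rewrite leqNgt aj.
have frontT a t : (a < j)%N -> life b setT t a -> t < T.
  move=> aj la; rewrite ltNge; apply/negP => Tt; apply: (front a aj).
  by apply: (process_down pL la) => //; apply: le_trans jT; exact/fire_time_le/ltnW.
have apart t k : t < T -> fire_time b j <= t -> k <> j -> life b setT t k ->
    position b t k <> position b t j.
  move=> tT jt kj lk e; have /pL[_ _ /(_ t tT)] := lj; apply.
  by split; [exact: (process_down pL lj _ (ltW tT))|exists k].
have pR : is_process b [set a | (a < j)%N]
    (fun t => life b setT t `&` [set a | (a < j)%N]).
  apply: (process_restrict pL) => // t a k /= aj /negP; rewrite -leqNgt => jk la lk e.
  have tT := frontT a t aj la.
  have [_ kt] := process_fired pL lk.
  have jt : fire_time b j <= t by apply: le_trans kt; exact: fire_time_le.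
  have lj' : life b setT t j by exact: (process_down pL lj _ (ltW tT)).
  apply: (apart t a tT jt _ la) => [aj'|]; first by rewrite aj' ltnn in aj.
  move: jk; rewrite leq_eqVlt => /orP[/eqP -> //|jk].
  have := process_order rb pL aj la lj'; have := process_order rb pL jk lj' lk.
  by rewrite e => ? ?; apply: le_anti; apply/andP.
split => //.
  have -> : upto j = [set a | (a < j)%N] `|` [set j].
    rewrite eqEsubset; split => a; rewrite /upto /=; last by move=> [/ltnW|->].
    by rewrite leq_eqVlt => /orP[/eqP ->|]; [right|left].
  apply: (immortal_add rb pR) => t a [la aj] jt; apply: apart => //.
    exact: frontT la.
  by move=> ae; rewrite /= ae ltnn in aj.
rewrite ltNge; apply/negP => vw.
have := ler_wpM2r (_ : 0 <= T - fire_time b j) vw; rewrite subr_ge0 => /(_ jT).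
move: ej; rewrite /position; have := mulr_gt0 w0 y0; have := mulr_ge0 (ltW w0) fire0.
lra.
Qed.

(** The trajectories of the two bullets meet once and nobody else takes part. *)
Lemma pair_process b : regular b -> (b 0%N).1 < (b 1%N).1 ->
  is_process b (upto 1)
    (fun t => [set i | [/\ (i <= 1)%N, fire_time b i <= t & t <= meeting_time b 0 1]]).
Proof.
move=> rb v01; have [sf e] := catch_up rb (ltnSn 0) v01.
set s := meeting_time b 0 1 in sf e *.
have sym i j t : (i <= 1)%N -> (j <= 1)%N -> j <> i ->
    position b t j = position b t i -> t = s.
  case: i j => [|[|i]] [|[|j]] // _ _ _ et; last exact: (meeting_timeP rb _ et).2.
  by apply: (meeting_timeP rb _ (esym et)).2.
move=> t i; split => /=.
  move=> [i1 it ts]; split => // u ut [_ [j [ji [j1 _ _] eu]]].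
  by have := sym i j u i1 j1 ji eu; lra.
move=> [i1 it h]; split => //; rewrite leNgt; apply/negP => st.
have fs k : (k <= 1)%N -> fire_time b k <= s.
  by move=> k1; apply: le_trans sf; exact: fire_time_le.
apply: (h s st); split; first by split => //; exact: fs.
case: i i1 {it h} => [|[|i]] // _; [exists 1%N|exists 0%N]; split => //; split => //; exact: fs.
Qed.

(** Bullet 1 is a fastest one, so later bullets stay behind it until the pair dies, and
    the pair stays behind the line because bullet 0 is not faster than w. The pair only
    serves to delay the others: the lead of the line grows by two delays. *)
Lemma nohit_pair b (w y : R) : regular b -> (b 0%N).1 < (b 1%N).1 ->
  (forall i, (b i).1 <= (b 1%N).1) -> (b 0%N).1 <= w -> 0 < w -> 0 < y ->
  nohit (shift 2 b) w (y + fire_time b 2) -> nohit b w y.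
Proof.
move=> rb v01 vle wge w0 y0 h; have pP := pair_process rb v01.
have d0 : 0 < (b 1%N).1 - (b 0%N).1 by rewrite subr_gt0.
have x10 t : t <= meeting_time b 0 1 -> position b t 1 <= position b t 0.
  rewrite /meeting_time ler_pdivlMr// /position !fire_time0 subr0; lra.
have v1 : 0 < (b 1%N).1 by apply: velocity_gt0.
have x2 t c : (2 <= c)%N -> fire_time b c <= t -> position b t c < position b t 1.
  move=> c2 ct; have t1c := fire_time_lt rb c2.
  have := ler_wpM2r (_ : 0 <= t - fire_time b c) (vle c); rewrite subr_ge0 => /(_ ct).
  have : 0 < (b 1%N).1 * (fire_time b c - fire_time b 1) by rewrite mulr_gt0//; lra.
  rewrite /position; lra.
have pU := process_union pP (lifeP (from 2) rb).
rewrite upto_from in pU.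
move=> t j /(lifeE _ _ rb (pU _))[].
- move=> s i c [i1 is_ sm] lc; have [c2 cs] := process_fired (lifeP _ rb) lc.
  have := x2 s c c2 cs; have := x10 s sm.
  by case: i i1 {is_} => [|[|i]] // _; lra.
- move=> [j1 jt tm] e.
  have : position b t j <= position b t 0.
    by case: j j1 {e jt} => [|[|j]] // _; exact: x10.
  have t0 : 0 <= t by apply: le_trans jt; rewrite -(fire_time0 b) fire_time_le.
  rewrite e /position fire_time0 subr0; have := ler_wpM2r t0 wge.
  have := mulr_gt0 w0 y0; lra.
- move=> lj; have [j2 jt] := process_fired (lifeP _ rb) lj.
  have := h (t - fire_time b 2) (j - 2)%N.
  rewrite (life_shift _ _ _ rb) position_shift subrK subnKC//.
  have -> : t - fire_time b 2 + (y + fire_time b 2) = t + y by lra.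
  by apply.
Qed.

Lemma immortalN b i : regular b -> ~ immortal b setT i ->
  exists D, forall t, D <= t -> ~ life b setT t i.
Proof.
move=> rb im; apply: contrapT => /forallNP h; apply: im; split => // t it.
have /existsNP[u /not_implyP[tu /contrapT lu]] := h t.
exact: (process_down (lifeP _ rb) lu).
Qed.

(** If all fast enough bullets of index below N die, they are dead after some time D,
    and a line with a large lead is hit only after D, hence by a bullet of index at
    least N. *)
Lemma late_hitters b (w hi delta : R) : regular b -> 0 < w -> 0 < hi -> 0 < delta ->
  (forall i, (b i).1 <= hi) -> (forall k : nat, ~ nohit b w (k.+1%:R * delta)) ->
  (forall j, immortal b setT j -> (b j).1 <= w) ->
  forall N : nat, exists n, [/\ (N <= n)%N, immortal b (upto n) n & w < (b n).1].
Proof.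
move=> rb w0 h0 d0 vle hit noim N.
have [D HD] : exists D, forall j t, (j < N)%N -> w < (b j).1 -> D <= t -> ~ life b setT t j.
  elim: N => [|N [D IH]]; first by exists 0.
  have [vN|vN] := leP (b N).1 w.
    exists D => j t; rewrite ltnS leq_eqVlt => /orP[/eqP ->|]; last exact: IH.
    by move=> /lt_le_trans/(_ vN); rewrite ltxx.
  have [D' HD'] : exists D, forall t, D <= t -> ~ life b setT t N.
    by apply: immortalN => // /noim; lra.
  exists (Num.max D D') => j t; rewrite ltnS ge_max leq_eqVlt.
  move=> /orP[/eqP -> _ /andP[_]|jN vj /andP[Dt _]]; first exact: HD'.
  exact: (IH j t).
(* A bullet reaches the line of lead y no earlier than w y / hi. *)
pose k := Num.trunc (hi * Num.max D 0 / (w * delta)).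
have wd : 0 < w * delta by rewrite mulr_gt0.
have hk : hi * Num.max D 0 < w * (k.+1%:R * delta).
  have := truncnS_gt (hi * Num.max D 0 / (w * delta)).
  by rewrite ltr_pdivrMr// -/k; lra.
have [|t [n [ln en imn vn]]] := first_hitter rb w0 _ (hit k).
  by rewrite mulr_gt0.
exists n; split => //; rewrite leqNgt; apply/negP => nN; apply: (HD n t nN vn _ ln).
have [_ nt] := process_fired (lifeP _ rb) ln.
have f0 : 0 <= fire_time b n by rewrite -(fire_time0 b) fire_time_le.
have : position b t n <= hi * t.
  have := ler_wpM2r (_ : 0 <= t - fire_time b n) (vle n); rewrite subr_ge0 => /(_ nt).
  rewrite /position; have := mulr_ge0 (ltW h0) f0; lra.
rewrite en => le1; have : hi * Num.max D 0 < hi * t.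
  apply: lt_le_trans le1; apply: (lt_le_trans hk); rewrite ler_pM2l//; lra.
by rewrite ltr_pM2l// gt_max => /andP[/ltW].
Qed.

End moving_lines.

(** * Measurability on the space of configurations *)

Section sequence_space.
Context {R : realType}.
Let E := (measurableTypeR R * measurableTypeR R)%type.

Definition coordinate_sets : set (set (nat -> E)) :=
  [set B | exists i U, measurable U /\ B = [set b | U (b i)]].

(** The product sigma-algebra on sequences of bullets, generated by the coordinates. *)
Definition configs := g_sigma_algebraType coordinate_sets.

Lemma measurable_coord i : measurable_fun [set: configs] (fun b : configs => b i : E).
Proof.
by move=> _ U mU; rewrite setTI; apply: sub_sigma_algebra; exists i, U.
Qed.

Lemma measurable_to_configs d (T : measurableType d) (f : T -> configs) :
  (forall i, measurable_fun [set: T] (fun x => f x i : E)) ->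
  measurable_fun [set: T] f.
Proof.
move=> mf; apply: (@measurability _ _ T configs setT f coordinate_sets erefl).
by move=> _ [_ [i [U [mU ->]]] <-]; exact: mf.
Qed.

Lemma measurable_velocity i : measurable_fun [set: configs] (fun b : configs => (b i).1 : R).
Proof. exact: (measurableT_comp measurable_fst (measurable_coord i)). Qed.

Lemma measurable_delay i : measurable_fun [set: configs] (fun b : configs => (b i).2 : R).
Proof. exact: (measurableT_comp measurable_snd (measurable_coord i)). Qed.

Lemma measurable_fire_time i :
  measurable_fun [set: configs] (fun b : configs => fire_time b i : R).
Proof.
elim: i => [|i IH].
  have -> : (fun b : configs => fire_time b 0 : R) = cst 0.
    by apply/funext => b; exact: fire_time0.
  exact: measurable_cst.
have -> : (fun b : configs => fire_time b i.+1 : R) =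
    (fun b : configs => fire_time b i + (b i.+1).2).
  by apply/funext => b; exact: fire_timeS.
by apply: measurable_funD => //; exact: measurable_delay.
Qed.

Section real_valued.
Context d (T : measurableType d).
Implicit Types f g : T -> R.

Lemma measurable_funV f : measurable_fun setT f -> measurable_fun setT (fun x => (f x)^-1).
Proof.
move=> mf.
(* Real powers are measurable; squaring makes the base nonnegative. *)
have -> : (fun x => (f x)^-1) = (fun x => f x * ((f x ^+ 2) `^ (-1))).
  apply/funext => x; rewrite powR_inv1 ?sqr_ge0//.
  have [->|f0] := eqVneq (f x) 0; first by rewrite invr0 mul0r.
  by rewrite expr2 invfM mulrA mulfV// mul1r.
apply: measurable_funM => //.
exact: (measurableT_comp (@measurable_powR R (-1)) (measurable_funX 2 mf)).
Qed.

Lemma measurable_set_le f g : measurable_fun setT f -> measurable_fun setT g ->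
  measurable [set x | f x <= g x].
Proof.
move=> mf mg; rewrite -[X in measurable X]setTI.
exact (measurable_fun_ler mf mg measurableT (I : measurable [set true])).
Qed.

Lemma measurable_set_lt f g : measurable_fun setT f -> measurable_fun setT g ->
  measurable [set x | f x < g x].
Proof.
move=> mf mg; rewrite -[X in measurable X]setTI.
exact: (measurable_fun_ltr mf mg measurableT (I : measurable [set true])).
Qed.

Lemma measurable_set_eq f g : measurable_fun setT f -> measurable_fun setT g ->
  measurable [set x | f x = g x].
Proof.
move=> mf mg; have -> : [set x | f x = g x] = [set x | f x <= g x] `&` [set x | g x <= f x].
  by apply/seteqP; split => x /=; [move=> ->|move=> [? ?]; apply: le_anti; apply/andP].
by apply: measurableI; exact: measurable_set_le.
Qed.

Lemma measurable_set_cst (Q : Prop) : measurable [set _ : T | Q].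
Proof.
have [q|nq] := pselect Q.
  by have -> : [set _ : T | Q] = setT by apply/seteqP; split.
by have -> : [set _ : T | Q] = set0 by apply/seteqP; split.
Qed.

Lemma measurable_set_imply (A B : set T) : measurable A -> measurable B ->
  measurable [set x | A x -> B x].
Proof.
move=> mA mB; have -> : [set x | A x -> B x] = ~` A `|` B.
  apply/seteqP; split => x /=; last by move=> [nA /nA|].
  by have [Ax /(_ Ax)|nA _] := pselect (A x); [right|left].
by apply: measurableU => //; exact: measurableC.
Qed.

Lemma measurable_set_forall (A : nat -> set T) : (forall i, measurable (A i)) ->
  measurable [set x | forall i, A i x].
Proof.
move=> mA; have -> : [set x | forall i, A i x] = \bigcap_i A i.
  by apply/seteqP; split => x h; [move=> i _|move=> i]; exact: h.
exact: bigcapT_measurable.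
Qed.

Lemma measurable_set_exists (A : nat -> set T) : (forall i, measurable (A i)) ->
  measurable [set x | exists i, A i x].
Proof.
move=> mA; have -> : [set x | exists i, A i x] = \bigcup_i A i.
  by apply/seteqP; split => x [i]; [exists i|move=> _ ?; exists i].
exact: bigcupT_measurable.
Qed.

End real_valued.

Lemma measurable_position (s : configs -> R) i : measurable_fun setT s ->
  measurable_fun [set: configs] (fun b : configs => position b (s b) i : R).
Proof.
move=> ms; apply: measurable_funM; first exact: measurable_velocity.
by apply: measurable_funB => //; exact: measurable_fire_time.
Qed.

Lemma measurable_meeting_time i j :
  measurable_fun [set: configs] (fun b : configs => meeting_time b i j : R).
Proof.
apply: measurable_funM.
  by apply: measurable_funB; apply: measurable_funM;
    [exact: measurable_velocity|exact: measurable_fire_time|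
     exact: measurable_velocity|exact: measurable_fire_time].
by apply: measurable_funV; apply: measurable_funB; exact: measurable_velocity.
Qed.

(** The statement quantifies over measurable random times so that the induction can
    evaluate the previous iterate at meeting times. *)
Lemma measurable_life_iter J n : forall (s : configs -> R) i,
  measurable_fun setT s -> measurable [set b : configs | life_iter b J n (s b) i].
Proof.
elim: n => [|n IH] s i ms /=.
  apply: measurableI; first exact: measurable_set_cst.
  by apply: measurable_set_le => //; exact: measurable_fire_time.
have -> : [set b : configs | life_iter b J n.+1 (s b) i] =
    [set b : configs | J i] `&` [set b | fire_time b i <= s b] `&`
    [set b : configs | forall j, [set b : configs | j <> i] b ->
       [set b : configs | meeting_time b i j < s b] b ->
       [set b : configs | position b (meeting_time b i j) j =
                          position b (meeting_time b i j) i] b ->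
       [set b : configs | life_iter b J n (meeting_time b i j) i] b ->
       (~` [set b : configs | life_iter b J n (meeting_time b i j) j]) b].
  by apply/seteqP; split => b [] => [|[]].
apply: measurableI; first apply: measurableI.
- exact: measurable_set_cst.
- by apply: measurable_set_le => //; exact: measurable_fire_time.
have mt j := measurable_meeting_time i j.
apply: measurable_set_forall => j.
apply: measurable_set_imply; first exact: measurable_set_cst.
apply: measurable_set_imply; first exact: measurable_set_lt.
apply: measurable_set_imply; first by apply: measurable_set_eq; exact: measurable_position.
apply: measurable_set_imply; first exact: IH.
by apply: measurableC; exact: IH.
Qed.

Lemma measurable_life J (s : configs -> R) i : measurable_fun setT s ->
  measurable [set b : configs | life b J (s b) i].
Proof.
move=> ms; apply: (measurable_set_exists
  (A := fun N => [set b : configs | forall m, (N <= m)%N -> life_iter b J m (s b) i])) => N.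
apply: measurable_set_forall => m; apply: measurable_set_imply.
  exact: measurable_set_cst.
exact: measurable_life_iter.
Qed.

(** Checking integer times after the firing is enough, since a bullet active at some
    time was active ever since it was fired; this makes the event measurable. *)
Definition forever (J : set nat) (i : nat) : set configs :=
  [set b | forall k : nat, life b J (fire_time b i + k%:R) i].

Lemma measurable_forever J i : measurable (forever J i).
Proof.
apply: measurable_set_forall => k; apply: measurable_life.
by apply: measurable_funD => //; exact: measurable_fire_time.
Qed.

Lemma foreverE J i (b : configs) : regular b -> J i -> forever J i b <-> immortal b J i.
Proof.
move=> rb Ji; split => [h|[_ h] k]; last by apply: h; rewrite lerDl.
split => // t it; apply: (process_down (lifeP J rb) (h (Num.trunc (t - fire_time b i)).+1)) => //.
by rewrite -lerBlDl; exact/ltW/truncnS_gt.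
Qed.

Lemma measurable_shift m : measurable_fun setT (shift m : configs -> configs).
Proof. by apply: measurable_to_configs => i; exact: measurable_coord. Qed.

Lemma measurable_shift_preimage m (A : set configs) : measurable A ->
  measurable (shift m @^-1` A : set configs).
Proof. by move=> mA; rewrite -[X in measurable X]setTI; exact: measurable_shift. Qed.

End sequence_space.

Arguments configs R : clear implicits.

(** * Independence of past and future *)

Section independence.
Context {R : realType}.
Local Notation E := (measurableTypeR R * measurableTypeR R)%type.
Local Open Scope ereal_scope.

Definition box (U : nat -> set E) (n : nat) : set (configs R) :=
  [set b | forall i, (i < n)%N -> U i (b i)].

Lemma measurable_box U n : (forall i, measurable (U i)) -> measurable (box U n).
Proof.
move=> mU; apply: (measurable_set_forall (A := fun i => [set b : configs R | (i < n)%N -> U i (b i)])) => i.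
apply: measurable_set_imply; first exact: measurable_set_cst.
by have := measurable_coord i measurableT (mU i); rewrite setTI.
Qed.

Lemma box_extend U n m : (n <= m)%N ->
  box U n = box (fun i => if (i < n)%N then U i else setT) m.
Proof.
move=> nm; apply/seteqP; split => b h i; first by move=> _; case: ifPn => // /h.
by move=> i_n; have := h i (leq_trans i_n nm); rewrite i_n.
Qed.

Definition boxes : set (set (configs R)) :=
  [set B | exists U n, (forall i, measurable (U i)) /\ B = box U n].

Lemma boxes_generate : @measurable _ (configs R) = <<s boxes >>.
Proof.
apply/seteqP; split; last first.
  apply: smallest_sub; first exact: sigma_algebra_measurable.
  by move=> _ [U [n [mU ->]]]; exact: measurable_box.
apply: smallest_sub; first exact: smallest_sigma_algebra.
move=> _ [i [U [mU ->]]]; apply: sub_sigma_algebra.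
exists (fun j => if j == i then U else setT), i.+1; split.
  by move=> j; case: ifP.
apply/seteqP; split => b.
  by move=> Ub j _; case: (eqVneq j i) => [->|].
by move=> /(_ i (ltnSn i)); rewrite eqxx.
Qed.

Lemma boxes_setI : setI_closed boxes.
Proof.
move=> _ _ [U [n [mU ->]]] [V [m [mV ->]]].
rewrite (box_extend U (leq_maxl n m)) (box_extend V (leq_maxr n m)).
eexists (fun i => (if (i < n)%N then U i else setT) `&` (if (i < m)%N then V i else setT)), (maxn n m).
split; first by move=> i; apply: measurableI; case: ifP.
apply/seteqP; split => b; first by move=> [hU hV] i im; split; [exact: hU|exact: hV].
by move=> h; split => i im; have [] := h i im.
Qed.

(** Independence of past and future says that restarting from an independent copy
    after time n does not change the law. *)
Definition splice n (p : configs R * configs R) : configs R :=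
  fun i => if (i <= n)%N then p.1 i else p.2 (i - n.+1)%N.

Lemma measurable_splice n : measurable_fun setT (splice n).
Proof.
apply: measurable_to_configs => i; rewrite /splice.
case: (i <= n)%N.
  exact: (measurableT_comp (measurable_coord i) measurable_fst).
exact: (measurableT_comp (measurable_coord _) measurable_snd).
Qed.

Definition past n (A : set (configs R)) : Prop :=
  measurable A /\
  forall b b', (forall i, (i <= n)%N -> b i = b' i) -> A b -> A b'.

Variables (rho : probability E R) (Q : probability (configs R) R).
Hypothesis Q_box : forall U n, (forall i, measurable (U i)) ->
  Q (box U n) = \prod_(i < n) rho (U i).

Lemma splice_box U n m : splice n @^-1` box U (n.+1 + m) =
  box U n.+1 `*` box (fun i => U (n.+1 + i)%N) m.
Proof.
apply/seteqP; split => -[b b'] /=.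
  move=> h; split => i im /=.
    by have := h i (leq_trans im (leq_addr _ _)); rewrite /splice -ltnS im.
  have := h (n.+1 + i)%N; rewrite ltn_add2l => /(_ im).
  by rewrite /splice leqNgt leq_addr/= addKn.
move=> [/= h h'] i im; rewrite /splice; case: leqP => [|ni]; first exact: h.
have := h' (i - n.+1)%N; rewrite subnKC//; apply.
by rewrite ltn_subLR.
Qed.

(** Both sides are measures in B, and on boxes both are the same finite product. *)
Lemma splice_law n (B : set (configs R)) : measurable B -> Q B = (Q \x Q) (splice n @^-1` B).
Proof.
have ms := measurable_splice n.
move=> mB; pose m2 : {measure set (configs R) -> \bar R} :=
  distribution (Q \x Q)%E (mfun_Sub (mem_set ms)).
rewrite -[RHS]/(m2 B).
apply: (@measure_unique _ _ _ boxes (fun=> setT) _ _ _ _ Q m2) => //.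
- exact: boxes_generate.
- exact: boxes_setI.
- by move=> _; exists (fun=> setT), 0%N; split => //; apply/seteqP; split.
- by apply/seteqP; split => // b _; exists 0%N.
- move=> _ [U [m [mU ->]]]; rewrite -[RHS]/((Q \x Q) (splice n @^-1` _)).
  pose V i := if (i < m)%N then U i else setT.
  have mV i : measurable (V i) by rewrite /V; case: ifP.
  rewrite (box_extend U (leq_addl n.+1 m)) -/V.
  have -> : (Q \x Q) (splice n @^-1` box V (n.+1 + m)) =
      Q (box V n.+1) * Q (box (fun i => V (n.+1 + i)%N) m).
    by rewrite splice_box product_measure1E//; exact: measurable_box.
  by apply: (etrans (Q_box _ mV)); rewrite !Q_box// big_split_ord.
- move=> _; apply: (@le_lt_trans _ _ 1); last exact: ltry.
  exact: (probability_le1 Q measurableT).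
Qed.

Lemma past_independent n (A B : set (configs R)) : past n A -> measurable B ->
  Q (A `&` (shift n.+1 @^-1` B)) = Q A * Q B.
Proof.
move=> [mA pA] mB.
have mS := measurable_shift_preimage n.+1 mB.
rewrite (splice_law n); last exact: measurableI.
rewrite -product_measure1E//; congr (_ _); apply/seteqP; split => -[b b'] /=.
  move=> [Ab Bb]; split => /=.
    by apply: pA Ab => i i_n; rewrite /splice i_n.
  move: Bb; congr (B _); apply/funext => i.
  by rewrite /shift /splice leqNgt leq_addr/= addKn.
move=> [Ab Bb]; split => /=.
  by apply: pA Ab => i i_n; rewrite /splice i_n.
move: Bb; congr (B _); apply/funext => i.
by rewrite /shift /splice leqNgt leq_addr/= addKn.
Qed.

Lemma shift_law m (B : set (configs R)) : measurable B -> Q (shift m @^-1` B) = Q B.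
Proof.
case: m => [|n] mB; first by congr (Q _).
have := @past_independent n setT B; rewrite setTI probability_setT mul1e; apply => //.
Qed.

End independence.

(** * Events that recur force a success *)

Section real_probability.
Context d (T : measurableType d) (R : realType) (P : probability T R).
Implicit Types A B : set T.

Definition pr A : R := fine (P A).

Lemma prE A : measurable A -> P A = (pr A)%:E.
Proof. by move=> mA; rewrite /pr fineK// fin_num_measure. Qed.

Lemma pr_ge0 A : 0 <= pr A.
Proof. exact/fine_ge0/measure_ge0. Qed.

Lemma pr_le1 A : measurable A -> pr A <= 1.
Proof. by move=> mA; rewrite -lee_fin -prE// probability_le1. Qed.

Lemma pr_le A B : measurable A -> measurable B -> A `<=` B -> pr A <= pr B.
Proof.
by move=> mA mB AB; rewrite -lee_fin -!prE//; apply: le_measure => //; rewrite inE.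
Qed.

Lemma pr_leU A B : measurable A -> measurable B -> pr (A `|` B) <= pr A + pr B.
Proof.
move=> mA mB; rewrite -lee_fin EFinD -!prE//; last exact: measurableU.
exact: measureU2.
Qed.

Lemma pr_cover A B C : measurable A -> measurable B -> measurable C ->
  A `<=` B `|` C -> pr A <= pr B + pr C.
Proof.
move=> mA mB mC ABC; apply: le_trans (pr_leU mB mC).
by apply: pr_le => //; exact: measurableU.
Qed.

Lemma pr_nondecreasing_union (F : nat -> set T) e : 0 < e ->
  (forall n, measurable (F n)) -> {homo F : n m / (n <= m)%N >-> (n <= m)%O} ->
  exists n, pr (\bigcup_k F k `\` F n) < e.
Proof.
move=> e0 mF ndF; set U := \bigcup_k F k.
have mU : measurable U by exact: bigcupT_measurable.
have mD n : measurable (U `\` F n) by exact: measurableD.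
have cap0 : \bigcap_n (U `\` F n) = set0.
  by apply/seteqP; split => // x h; have [[k _ Fkx] _] := h 0%N I; have [_ []] := h k I.
have cv : (P \o (fun n => U `\` F n)) x @[x --> \oo] --> P (\bigcap_n (U `\` F n)).
  apply: nonincreasing_cvg_mu => //.
  - exact: (le_lt_trans (probability_le1 P (mD 0%N)) (ltry 1)).
  - by rewrite cap0.
  - move=> n m nm; apply/subsetPset; apply: setDS; exact/subsetPset/ndF.
rewrite cap0 measure0 in cv.
have nb : nbhs (0 : \bar R)%E [set y | (y < e%:E)%E].
  by apply: open_nbhs_nbhs; split; [exact: open_ereal_lt_ereal|rewrite /= lte_fin].
have [N _ /(_ N (leqnn N)) /= h] := cv _ nb.
by exists N; rewrite -lte_fin -prE.
Qed.

Lemma negligible_setC A : measurable A -> P A = 1%E -> P.-negligible (~` A).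
Proof.
move=> mA PA; apply/negligibleP; first exact: measurableC.
by apply: (etrans (probability_setC P mA)); rewrite PA subee.
Qed.

End real_probability.

Section trials.
Context {R : realType}.
Local Notation E := (measurableTypeR R * measurableTypeR R)%type.
Variables (rho : probability E R) (Q : probability (configs R) R).
Hypothesis Q_box : forall U n, (forall i, measurable (U i)) ->
  Q (box U n) = (\prod_(i < n) rho (U i))%E.

Lemma past_measurable n (A : set (configs R)) : past n A -> measurable A.
Proof. by case. Qed.

Lemma past_le n m (A : set (configs R)) : (n <= m)%N -> past n A -> past m A.
Proof.
move=> nm [mA pA]; split => // b b' bb; apply: pA => i i_n.
by apply: bb; exact: leq_trans nm.
Qed.

Lemma past_set0 n : past n (set0 : set (configs R)).
Proof. by split. Qed.

Lemma pastI n (A B : set (configs R)) : past n A -> past n B -> past n (A `&` B).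
Proof.
move=> [mA pA] [mB pB]; split; first exact: measurableI.
by move=> b b' bb [/(pA _ _ bb) ? /(pB _ _ bb) ?].
Qed.

Lemma pastU n (A B : set (configs R)) : past n A -> past n B -> past n (A `|` B).
Proof.
move=> [mA pA] [mB pB]; split; first exact: measurableU.
by move=> b b' bb [/(pA _ _ bb) ?|/(pB _ _ bb) ?]; [left|right].
Qed.

Lemma pastC n (A : set (configs R)) : past n A -> past n (~` A).
Proof.
move=> [mA pA]; split; first exact: measurableC.
by move=> b b' bb nA /(pA b' b) h; apply: nA; apply: h => i i_n; rewrite bb.
Qed.

(** Approximation by events of finitely many bullets; it takes the place of the
    convergence of conditional probabilities in the Levy zero-one law. *)
Definition approximable (B : set (configs R)) : Prop :=
  forall e : R, 0 < e -> exists n A,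
    [/\ past n A, pr Q (A `\` B) < e & pr Q (B `\` A) < e].

Lemma approximableU (B C : set (configs R)) : measurable B -> measurable C ->
  approximable B -> approximable C -> approximable (B `|` C).
Proof.
move=> mB mC aB aC e e0; have e20 : 0 < e / 2 by lra.
have [n [A [pA AB BA]]] := aB _ e20; have [m [D [pD DC CD]]] := aC _ e20.
have mA := past_measurable pA; have mD := past_measurable pD.
exists (maxn n m), (A `|` D); split.
- by apply: pastU; [apply: past_le pA; exact: leq_maxl|apply: past_le pD; exact: leq_maxr].
- have : pr Q ((A `|` D) `\` (B `|` C)) <= pr Q (A `\` B) + pr Q (D `\` C).
    apply: pr_cover; [|exact: measurableD..|].
      by apply: measurableD; exact: measurableU.
    by move=> b [[Ab|Db] nBC]; [left|right]; split => // ?; apply: nBC; [left|right].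
  lra.
- have : pr Q ((B `|` C) `\` (A `|` D)) <= pr Q (B `\` A) + pr Q (C `\` D).
    apply: pr_cover; [|exact: measurableD..|].
      by apply: measurableD; exact: measurableU.
    by move=> b [[Ab|Db] nBC]; [left|right]; split => // ?; apply: nBC; [left|right].
  lra.
Qed.

Lemma approximable_bigcup (F : nat -> set (configs R)) :
  (forall k, measurable (F k)) -> (forall k, approximable (F k)) ->
  approximable (\bigcup_k F k).
Proof.
move=> mF aF.
pose G n : set (configs R) := \big[setU/set0]_(i < n) F i.
have mG n : measurable (G n) by exact: bigsetU_measurable.
have aG n : approximable (G n).
  elim: n => [|n IH]; rewrite /G.
    rewrite big_ord0 => e e0; exists 0%N, set0; rewrite setDv /pr measure0.
    by split => //; exact: past_set0.
  rewrite big_ord_recr/=; apply: approximableU.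
  - exact: mG.
  - exact: mF.
  - exact: IH.
  - exact: aF.
have GF : \bigcup_k F k = \bigcup_n G n.
  apply/seteqP; split => b [k _].
    by move=> Fb; exists k.+1 => //; rewrite /G -bigcup_mkord; exists k => /=.
  by rewrite /G -bigcup_mkord => -[i _ Fb]; exists i.
move=> e e0; have e20 : 0 < e / 2 by lra.
have [|N hN] := pr_nondecreasing_union Q e20 mG.
  by move=> n m nm; apply/subsetPset; exact: subset_bigsetU.
rewrite GF; have [n [A [pA AG GA]]] := aG N _ e20; have mA := past_measurable pA.
have mU : measurable (\bigcup_n G n) by exact: bigcupT_measurable.
exists n, A; split => //.
- apply: (@le_lt_trans _ _ (pr Q (A `\` G N))); last lra.
  apply: pr_le; [exact: measurableD..|].
  by apply: setDS => b Gb; exists N.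
- have : pr Q (\bigcup_n G n `\` A) <= pr Q (\bigcup_n G n `\` G N) + pr Q (G N `\` A).
    apply: pr_cover; [exact: measurableD..|].
    by move=> b [Ub nA]; have [Gb|nG] := pselect (G N b); [right|left].
  lra.
Qed.

Lemma measurable_approximable : measurable `<=` approximable.
Proof.
suff h : measurable `<=` [set B | measurable B /\ approximable B].
  by move=> B /h[].
apply: smallest_sub; last first.
  move=> B [i [U [mU ->]]].
  have mB : measurable [set b : configs R | U (b i)].
    by rewrite -[X in measurable X]setTI; exact: measurable_coord.
  split => // e e0; exists i, [set b | U (b i)]; rewrite setDv /pr measure0.
  by split => //; split => // b b' bb /=; rewrite bb.
split.
- split => // e e0; exists 0%N, set0; rewrite setDv /pr measure0.
  by split => //; exact: past_set0.
- move=> B [mB aB]; rewrite setTD; split; first exact: measurableC.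
  move=> e e0; have [n [A [pA AB BA]]] := aB _ e0; exists n, (~` A).
  split; first exact: pastC.
    by rewrite setDE setCK setIC -setDE.
  by rewrite setDE setCK setIC -setDE.
move=> F aF; split; first by apply: bigcupT_measurable => k; exact: (aF k).1.
by apply: approximable_bigcup => k; have [] := aF k.
Qed.

(** If I had probability q > 0, approximate it by an event A of the past of n0 and
    wait, after n0, for the first n with Ev n. That n is found almost everywhere on I,
    and given the past the next trial succeeds with probability c = Q H. So about
    c q of the mass of A fails to lie in I, which is more than the approximation
    allows. *)
Lemma trials (Ev : nat -> set (configs R)) (H I : set (configs R)) k :
  (forall n, past n (Ev n)) -> measurable H -> (0 < Q H)%E -> measurable I ->
  (forall b, I b -> forall N, exists2 n, (N <= n)%N & Ev n b) ->
  (forall n b, (k <= n)%N -> I b -> Ev n b -> ~ H (shift n.+1 b)) ->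
  Q I = 0%E.
Proof.
move=> pE mH QH mI io fails; apply/eqP; rewrite prE// eqe eq_le pr_ge0 andbT leNgt.
apply/negP => q0; have c0 : 0 < pr Q H by rewrite -lte_fin -prE.
have c1 : pr Q H <= 1 by exact: pr_le1.
set q := pr Q I in q0 *; set c := pr Q H in c0 c1 *.
have cq0 : 0 < c * q by rewrite mulr_gt0.
(* The total error 2 (c q / 4) is less than the mass c q of the successes. *)
have [|n0 [A [pA AI IA]]] := measurable_approximable mI (e:= c * q / 4); first lra.
have mA := past_measurable pA.
pose N0 := maxn n0 k.
(* On A, seqDU F n says that n is the first index from N0 on with Ev n. *)
pose F n := if (N0 <= n)%N then A `&` Ev n else set0.
have pF n : past n (F n).
  rewrite /F; case: ifPn => [Nn|_]; last exact: past_set0.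
  apply: pastI => //; apply: past_le pA.
  exact: leq_trans (leq_maxl _ _) Nn.
have pW n : past n (seqDU F n).
  rewrite /seqDU setDE; apply: pastI => //; apply: pastC.
  suff h m : (m <= n)%N -> past n (\big[setU/set0]_(j < m) F j) by exact: h.
  elim: m => [|m IH] mn; first by rewrite big_ord0; exact: past_set0.
  rewrite big_ord_recr/=; apply: pastU; first exact/IH/ltnW.
  exact: past_le (ltnW mn) (pF m).
have mW n := past_measurable (pW n).
pose S n := shift n.+1 @^-1` H : set (configs R).
have mS n : measurable (S n) by exact: measurable_shift_preimage.
have QWS n : Q (seqDU F n `&` S n) = (c%:E * Q (seqDU F n))%E.
  by rewrite (past_independent Q_box (pW n) mH) (prE _ mH) muleC.
have tW := trivIset_seqDU F.
have tWS : trivIset setT (fun n => seqDU F n `&` S n).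
  move=> i j _ _ [b [[Wi _] [Wj _]]]; apply: tW => //; by exists b.
have mUW : measurable (\bigcup_n seqDU F n) by exact: bigcupT_measurable.
have mUS : measurable (\bigcup_n (seqDU F n `&` S n)).
  by apply: bigcupT_measurable => n; exact: measurableI.
have E : pr Q (\bigcup_n (seqDU F n `&` S n)) = c * pr Q (\bigcup_n seqDU F n).
  apply: EFin_inj; rewrite EFinM -!prE//.
  rewrite !measure_bigcup//; last by move=> n _; exact: measurableI.
  apply: (etrans (eq_eseriesr (fun n _ => QWS n))).
  by rewrite nneseriesZl ?(prE _ mH)// => n _; exact: measure_ge0.
have le1 : pr Q (\bigcup_n (seqDU F n `&` S n)) <= pr Q (A `\` I).
  apply: pr_le => //; first exact: measurableD.
  move=> b [n _ [Wb]]; move: (subset_seqDU Wb); rewrite /F /S; case: ifPn => // Nn [Ab Eb] Hb.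
  by split => // Ib; apply: (fails n b) => //; exact: leq_trans (leq_maxr _ _) Nn.
have le2 : q <= pr Q (\bigcup_n seqDU F n) + pr Q (I `\` A).
  apply: pr_cover => //; first exact: measurableD.
  move=> b Ib; have [Ab|nA] := pselect (A b); last by right.
  left; rewrite -seqDU_bigcup_eq; have [n Nn Eb] := io b Ib N0.
  by exists n => //; rewrite /F Nn.
have : c * q <= c * (pr Q (\bigcup_n seqDU F n) + pr Q (I `\` A)).
  by rewrite ler_pM2l.
rewrite mulrDr -E; have : c * pr Q (I `\` A) <= pr Q (I `\` A).
  by rewrite ler_piMl// pr_ge0.
lra.
Qed.

End trials.

(** * The survival event of a ghost *)

Section ghosts.
Context {R : realType}.
Implicit Types (b c : nat -> R * R).

(** Bullet 0 is constrained like the others because it becomes bullet 1 once a ghost is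
    put in front. *)
Definition good c : Prop :=
  [/\ forall i, 0 < (c i).1, forall i, 0 < (c i).2 &
      forall M, exists i, M < fire_time c i].

Lemma good_regular c : good c -> regular c.
Proof. by move=> [v d u]; split => //; exact/ltW. Qed.

Lemma good_shift m c : good c -> good (shift m c).
Proof.
move=> gc; have [v d _] := gc; split => [i|i|]; rewrite /shift//.
by have [_ _ _] := regular_shift m (good_regular gc).
Qed.

(** Bullet 0 of c becomes bullet 1, so its delay, of no effect in c, is now the lead
    of the ghost. *)
Definition front (w : R) c : nat -> R * R := fun i => if i is j.+1 then c j else (w, 0).

Lemma fire_time_front w c i : fire_time (front w c) i.+1 = (c 0%N).2 + fire_time c i.
Proof.
elim: i => [|i IH]; first by rewrite fire_timeS !fire_time0 addr0 add0r.
by rewrite fire_timeS IH fire_timeS addrA.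
Qed.

Lemma regular_front w c : 0 <= w -> good c -> regular (front w c).
Proof.
move=> w0 [v d u]; split => // M; have [i Mi] := u (M - (c 0%N).2).
by exists i.+1; rewrite fire_time_front; lra.
Qed.

Lemma shift1_front w c : shift 1 (front w c) = c.
Proof. by apply/funext => i; rewrite /shift add1n. Qed.

Lemma survives_front w c : 0 <= w -> good c ->
  survives (front w c) 0 <-> nohit c w (c 0%N).2.
Proof.
move=> w0 gc; have := ghostE (regular_front w0 gc) w0.
rewrite shift1_front /= => <-; suff -> : set_velocity0 (front w c) w = front w c by [].
by apply/funext => -[].
Qed.

(** Prescribing the delay of bullet 0 prescribes the lead of a ghost put in front of c. *)
Definition delay0 (y : R) c : nat -> R * R :=
  fun i => if i is 0%N then ((c 0%N).1, y) else c i.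

Lemma fire_time_delay0 y c i : fire_time (delay0 y c) i = fire_time c i.
Proof. by elim: i => [|i IH]; rewrite ?fire_time0// !fire_timeS IH. Qed.

Lemma good_delay0 y c : 0 < y -> good c -> good (delay0 y c).
Proof.
move=> y0 [v d u]; split.
- by case => [|i]; exact: v.
- by case => [|i]; [|exact: d].
move=> M.
by have [i Mi] := u M; exists i; rewrite fire_time_delay0.
Qed.

Lemma nohit_delay0 y w y' c : nohit (delay0 y c) w y' <-> nohit c w y'.
Proof.
have E i : fire_time (delay0 y c) i = fire_time c i /\ (delay0 y c i).1 = (c i).1.
  by rewrite fire_time_delay0; case: i.
have L t i : life (delay0 y c) setT t i <-> life c setT t i.
  by apply: life_congr => j _; exact: E.
have pE t i : position (delay0 y c) t i = position c t i.
  by rewrite /position (E i).1 (E i).2.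
split => h t i.
  by move=> /L/h; rewrite pE.
by move=> /L/h; rewrite pE.
Qed.

Definition ghost (w : R) : set (configs R) := [set c | forever setT 0 (front w c : configs R)].

(** A measurable version of [nohit] with a prescribed lead, obtained by reducing it to
    the survival of a ghost. *)
Definition unhit (w y : R) : set (configs R) := [set c | ghost w (delay0 y c)].

Lemma measurable_ghost w : measurable (ghost w).
Proof.
have mf : measurable_fun setT (front w : configs R -> configs R).
  by apply: measurable_to_configs => -[|i]; [exact: measurable_cst|exact: measurable_coord].
rewrite -[X in measurable X]setTI; exact: (mf measurableT _ (measurable_forever _ _)).
Qed.

Lemma measurable_unhit w y : measurable (unhit w y).
Proof.
have mf : measurable_fun setT (delay0 y : configs R -> configs R).
  apply: measurable_to_configs => -[|i]; last exact: measurable_coord.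
  apply: measurable_fun_pair; first exact: measurable_velocity.
  exact: measurable_cst.
rewrite -[X in measurable X]setTI; exact: (mf measurableT _ (measurable_ghost _)).
Qed.

Lemma ghost_nohit w c : 0 <= w -> good c -> ghost w c <-> nohit c w (c 0%N).2.
Proof.
move=> w0 gc; have rf := regular_front w0 gc.
rewrite -survives_front// survivesE//; exact: foreverE.
Qed.

Lemma unhit_nohit w y c : 0 <= w -> 0 < y -> good c -> unhit w y c <-> nohit c w y.
Proof.
move=> w0 y0 gc.
by rewrite -(nohit_delay0 y) -(ghost_nohit w0 (good_delay0 y0 gc)).
Qed.

Lemma ghost_first c : good c -> ghost (c 0%N).1 (shift 1 c) <-> immortal c setT 0.
Proof.
move=> gc; have rc := good_regular gc.
have w0 : 0 <= (c 0%N).1 by exact: velocity_ge0.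
rewrite ghost_nohit//; last exact: good_shift.
rewrite -survivesE// -[X in survives X](_ : set_velocity0 c (c 0%N).1 = c).
  by rewrite (ghostE rc w0).
by apply/funext => -[|i] //=; rewrite /set_velocity0/= -surjective_pairing.
Qed.

End ghosts.

(** * Typical configurations *)

Section almost_sure.
Context {R : realType}.
Local Notation E := (measurableTypeR R * measurableTypeR R)%type.
Variables (rho : probability E R) (Q : probability (configs R) R).
Hypothesis Q_box : forall U n, (forall i, measurable (U i)) ->
  Q (box U n) = (\prod_(i < n) rho (U i))%E.

Lemma negligible_measurable (A : set (configs R)) : measurable A ->
  Q A = 0%E -> Q.-negligible A.
Proof. by move=> mA QA; apply/negligibleP. Qed.

Lemma negligible_eq0 (A : set (configs R)) : measurable A ->
  Q.-negligible A -> Q A = 0%E.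
Proof. by move=> mA /negligibleP; apply. Qed.

Lemma negligible_shift m (A : set (configs R)) : Q.-negligible A ->
  Q.-negligible (shift m @^-1` A : set (configs R)).
Proof.
move=> [B [mB QB AB]]; exists (shift m @^-1` B); split.
- exact: measurable_shift_preimage.
- by apply: (etrans (shift_law Q_box m mB)).
- by move=> b; exact: AB.
Qed.

Lemma Q_first (U : set E) : measurable U -> Q [set b | U (b 0%N)] = rho U.
Proof.
move=> mU; have -> : [set b : configs R | U (b 0%N)] = box (fun=> U) 1.
  apply/seteqP; split => b; first by move=> Ub i; rewrite ltnS leqn0 => /eqP ->.
  exact.
by rewrite Q_box// big_ord_recl big_ord0 mule1.
Qed.

Lemma measurable_first (U : set E) : measurable U ->
  measurable [set b : configs R | U (b 0%N)].
Proof. by move=> mU; rewrite -[X in measurable X]setTI; exact: measurable_coord. Qed.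

Lemma negligible_coord (U : set E) : measurable U -> rho U = 0%E ->
  Q.-negligible [set b | exists i, U (b i)].
Proof.
move=> mU rU; rewrite [X in Q.-negligible X](_ : _ =
    \bigcup_i (shift i @^-1` [set b : configs R | U (b 0%N)] : set (configs R))).
  apply: negligible_bigcup => i; apply: negligible_shift.
  by apply: negligible_measurable; [exact: measurable_first|exact: etrans (Q_first mU) _].
apply/seteqP; split => b [i].
  by move=> Ub; exists i => //; rewrite /= /shift addn0.
by move=> _; rewrite /= /shift addn0 => Ub; exists i.
Qed.

(** Success here is a delay longer than delta, which has positive probability at each
    index. *)
Lemma long_delays_recur (delta : R) : (0 < rho [set p | (delta < p.2)%R])%E ->
  Q.-negligible [set b | exists k, forall i, (k < i)%N -> (b i).2 <= delta].
Proof.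
move=> pd; have mU : measurable [set p : E | delta < p.2].
  apply: measurable_set_lt; first exact: measurable_cst.
  exact: measurable_snd.
rewrite [X in Q.-negligible X](_ : _ =
    \bigcup_k [set b : configs R | forall i, (k < i)%N -> (b i).2 <= delta]); last first.
  by apply/seteqP; split => b [k]; [exists k|move=> _ ?; exists k].
apply: negligible_bigcup => k.
have mI : measurable [set b : configs R | forall i, (k < i)%N -> (b i).2 <= delta].
  apply: (measurable_set_forall (A := fun i => [set b : configs R | (k < i)%N -> (b i).2 <= delta])) => i.
  apply: measurable_set_imply; first exact: measurable_set_cst.
  by apply: measurable_set_le; [exact: measurable_delay|exact: measurable_cst].
apply: negligible_measurable => //.
apply: (trials Q_box (Ev := fun=> setT) (k := k) _ (measurable_first mU)) => //.
- by rewrite (Q_first mU).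
- by move=> b _ N; exists N.
- move=> n b kn Ib _; rewrite /= /shift addn0 => h.
  by have := Ib n.+1 kn; lra.
Qed.

Lemma long_delays_unbounded (b : nat -> R * R) (delta : R) : 0 < delta -> (forall i, 0 < (b i).2) ->
  ~ (exists k, forall i, (k < i)%N -> (b i).2 <= delta) ->
  forall M, exists i, M < fire_time b i.
Proof.
move=> d0 bpos /forallNP io.
have step i : fire_time b i <= fire_time b i.+1.
  by rewrite fire_timeS lerDl ltW.
have mono i j : (i <= j)%N -> fire_time b i <= fire_time b j.
  apply: (homo_leq (r := fun x y : R => x <= y)) => // y x z; exact: le_trans.
have H n : exists i, n%:R * delta <= fire_time b i.
  elim: n => [|n [i IH]]; first by exists 0%N; rewrite mul0r fire_time0.
  have /existsNP[j /not_implyP[ij /negP]] := io i; rewrite -ltNge => dj.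
  exists j; case: j ij dj => // j ij dj; rewrite fire_timeS.
  have := mono i j ij; rewrite -natr1 mulrDl mul1r; lra.
move=> M; have [i hi] := H (Num.trunc (M / delta)).+1; exists i.
apply: lt_le_trans hi; rewrite -ltr_pdivrMr//; exact: truncnS_gt.
Qed.

Variable V : set R.
Hypothesis mV : measurable V.
Hypothesis rho_V : rho [set p | V p.1] = 1%E.
Hypothesis V_gt0 : forall s, V s -> 0 < s.
Hypothesis rho_delay : rho [set p | 0 < p.2] = 1%E.

Lemma measurable_setV : measurable [set p : E | V p.1].
Proof.
rewrite -[X in measurable X]setTI; exact: measurable_fst.
Qed.

Lemma exists_long_delay : exists2 delta : R, 0 < delta & (0 < rho [set p | (delta < p.2)%R])%E.
Proof.
apply: contrapT => h.
have mU (x : R) : measurable [set p : E | (x < p.2)%R].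
  apply: measurable_set_lt; first exact: measurable_cst.
  exact: measurable_snd.
have z (n : nat) : rho [set p | (n.+1%:R^-1 < p.2)%R] = 0%E.
  apply/eqP; rewrite eq_le measure_ge0 andbT leNgt; apply/negP => hn.
  by apply: h; exists n.+1%:R^-1.
have : rho.-negligible [set p | (0 < p.2)%R].
  apply: (@negligibleS _ _ _ _ (\bigcup_n [set p : E | (n.+1%:R^-1 < p.2)%R])).
    move=> p p0; have [n hn] : exists n : nat, n.+1%:R^-1 < p.2.
      exists (Num.trunc (p.2)^-1).
      by rewrite invf_plt ?posrE// truncnS_gt.
    by exists n.
  by apply: negligible_bigcup => n; apply/negligibleP => //; exact: z.
move=> /negligibleP e; have /eqP := etrans (esym rho_delay) (e (mU 0)).
by rewrite onee_eq0.
Qed.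

Definition typical : set (configs R) :=
  [set c | (forall i, V (c i).1) /\ good c].

(** Firing times tend to infinity because delays longer than some delta > 0 recur. *)
Lemma negligible_not_typical : Q.-negligible (~` typical).
Proof.
have [delta d0 pd] := exists_long_delay.
pose U : set E := ~` [set p | V p.1] `|` ~` [set p | (0 < p.2)%R].
have m2 : measurable [set p : E | (0 < p.2)%R].
  apply: measurable_set_lt; first exact: measurable_cst.
  exact: measurable_snd.
have mU : measurable U.
  by apply: measurableU; apply: measurableC => //; exact: measurable_setV.
have rU : rho U = 0%E.
  apply/negligibleP => //; apply: negligibleU.
    by apply: negligible_setC => //; exact: measurable_setV.
  exact: negligible_setC.
apply: negligibleS (negligibleU (negligible_coord mU rU) (long_delays_recur pd)).
move=> c; apply: contra_notP => /not_orP[/forallNP h1 h2].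
have hV i : V (c i).1 by apply: contrapT => nV; apply: (h1 i); left.
have hd i : 0 < (c i).2 by apply: contrapT => nd; apply: (h1 i); right.
split => //; split => //; first by move=> i; exact: V_gt0.
exact: long_delays_unbounded h2.
Qed.

Lemma measurable_typical : measurable typical.
Proof.
have -> : typical = [set c : configs R | forall i, V (c i).1] `&`
    ([set c : configs R | forall i, 0 < (c i).2] `&`
     [set c : configs R | forall n : nat, exists i, n%:R < fire_time c i]).
  apply/seteqP; split => c.
    by move=> [hV [_ hd hu]]; split => //; split => // n; exact: hu.
  move=> [hV [hd hu]]; split => //; split => //; first by move=> i; exact: V_gt0.
  move=> M; have [i hi] := hu (Num.trunc M).+1; exists i.
  by apply: lt_trans hi; exact: truncnS_gt.
apply: measurableI; [|apply: measurableI].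
- apply: (measurable_set_forall (A := fun i => [set c : configs R | V (c i).1])) => i.
  by rewrite -[X in measurable X]setTI; exact: measurable_velocity.
- apply: (measurable_set_forall (A := fun i => [set c : configs R | 0 < (c i).2])) => i.
  by apply: measurable_set_lt; [exact: measurable_cst|exact: measurable_delay].
- apply: (measurable_set_forall (A := fun n : nat => [set c : configs R | exists i, n%:R < fire_time c i])) => n.
  apply: (measurable_set_exists (A := fun i => [set c : configs R | n%:R < fire_time c i])) => i.
  by apply: measurable_set_lt; [exact: measurable_cst|exact: measurable_fire_time].
Qed.

End almost_sure.

(** * The almost sure picture under the law of the bullets *)

Lemma seq_min (R : realType) (s : seq R) (A : R -> Prop) :
  (exists2 x, x \in s & A x) ->
  exists x, [/\ x \in s, A x & forall y, y \in s -> A y -> x <= y].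
Proof.
elim: s => [[x]//|z s IH [x xs Ax]].
have [ex|nex] := pselect (exists2 x, x \in s & A x); last first.
  have xz : x = z.
    by move: xs; rewrite in_cons => /orP[/eqP//|xs]; exfalso; apply: nex; exists x.
  exists x; split => // y; rewrite in_cons xz => /orP[/eqP -> //|ys Ay].
  by exfalso; apply: nex; exists y.
have [u [us Au umin]] := IH ex.
have [[Az zu]|h] := pselect (A z /\ z <= u).
  exists z; rewrite mem_head; split => // y; rewrite in_cons => /orP[/eqP -> //|ys Ay].
  exact: le_trans zu (umin y ys Ay).
exists u; rewrite in_cons us orbT; split => // y; rewrite in_cons => /orP[/eqP -> Az|]; last exact: umin.
by rewrite leNgt; apply/negP => zu; apply: h; split => //; exact: ltW.
Qed.

Lemma seq_max (R : realType) (s : seq R) (A : R -> Prop) :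
  (exists2 x, x \in s & A x) ->
  exists x, [/\ x \in s, A x & forall y, y \in s -> A y -> y <= x].
Proof.
move=> [x xs Ax].
have [|u [us Au umax]] := @seq_min R [seq - x | x <- s] (fun x => A (- x)).
  by exists (- x); [exact: map_f|rewrite opprK].
exists (- u); split => //.
  by move: us => /mapP[z zs ->]; rewrite opprK.
by move=> y ys Ay; rewrite lerNr; apply: umax; [exact: map_f|rewrite opprK].
Qed.

Section core.
Context {R : realType}.
Local Notation E := (measurableTypeR R * measurableTypeR R)%type.
Variables (rho : probability E R) (Q : probability (configs R) R).
Hypothesis Q_box : forall U n, (forall i, measurable (U i)) ->
  Q (box U n) = (\prod_(i < n) rho (U i))%E.
Variable vs : seq R.
Local Notation V := [set` vs].
Hypothesis rho_V : rho [set p | V p.1] = 1%E.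
Hypothesis V_gt0 : forall s, V s -> 0 < s.
Hypothesis rho_delay : rho [set p | 0 < p.2] = 1%E.
Hypothesis rho_atom : forall s delta, V s -> (0 < rho [set p | (delta < p.2)%R])%E ->
  (0 < rho [set p | p.1 = s /\ (delta < p.2)%R])%E.

Lemma measurable_speeds : measurable (V : set R).
Proof.
apply: countable_measurable; first by move=> t; exact: measurable_set1.
by apply: finite_set_countable; apply/finite_seqP; exists vs.
Qed.

Local Notation typical := (@typical R V).
Let not_typical := negligible_not_typical Q_box measurable_speeds rho_V V_gt0 rho_delay.
Let m_typical := measurable_typical measurable_speeds V_gt0.

Lemma typical_shift m c : typical c -> typical (shift m c).
Proof. by move=> [h g]; split; [move=> i; exact: h|exact: good_shift]. Qed.

Lemma measurable_atom (s delta : R) : measurable [set p : E | p.1 = s /\ delta < p.2].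
Proof.
apply: (@measurableI _ _ [set p : E | p.1 = s] [set p : E | delta < p.2]).
  by apply: measurable_set_eq; [exact: measurable_fst|exact: measurable_cst].
by apply: measurable_set_lt; [exact: measurable_cst|exact: measurable_snd].
Qed.

Section pairs.
Variables (lo hi delta : R).
Hypotheses (Vlo : V lo) (Vhi : V hi) (lohi : lo < hi).
Hypothesis le_hi : forall s, V s -> s <= hi.
Hypotheses (delta0 : 0 < delta) (long : (0 < rho [set p | (delta < p.2)%R])%E).

Definition pair_start : set (configs R) := [set c |
  ((c 0%N).1 = lo /\ delta < (c 0%N).2) /\ ((c 1%N).1 = hi /\ delta < (c 1%N).2)].

Lemma pair_startE : pair_start = box (fun i => if i == 0%N
  then [set p | p.1 = lo /\ delta < p.2] else [set p | p.1 = hi /\ delta < p.2]) 2.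
Proof.
apply/seteqP; split => c; first by move=> [h0 h1] [|[|i]].
by move=> h; split; [exact: (h 0%N)|exact: (h 1%N)].
Qed.

Lemma past_pair_start : past 1 pair_start.
Proof.
split; last by move=> c c' cc; rewrite /pair_start /= !cc.
rewrite pair_startE; apply: measurable_box => i.
by case: ifP => _; exact: measurable_atom.
Qed.

Lemma pair_start_gt0 : (0 < Q pair_start)%E.
Proof.
rewrite pair_startE Q_box; last by move=> i; case: ifP => _; exact: measurable_atom.
by rewrite !big_ord_recl big_ord0/= mule1 mule_gt0// rho_atom.
Qed.

(** The condition on the delays makes the lead grow by at least delta. *)
Lemma pair_unhit (w : R) (y z : R) c : lo <= w -> 0 < y -> 0 <= z -> z <= y + delta ->
  typical c -> pair_start c -> nohit (shift 2 c) w z -> nohit c w y.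
Proof.
move=> low y0 z0 zy [cV gc] [[v0 _] [v1 d1]] h.
have rc := good_regular gc; have w0 : 0 < w by apply: lt_le_trans low; exact: V_gt0.
apply: nohit_pair => //; first by rewrite v0 v1.
- by move=> i; rewrite v1; exact: le_hi.
- by rewrite v0.
apply: nohit_le h => //; first exact: regular_shift.
  exact: ltW.
have [_ d _] := gc; have := d 2%N.
by rewrite !fire_timeS fire_time0; lra.
Qed.

(** The start and the sequence after it are independent, and a pair comes first with
    positive probability. *)
Lemma pair_transfer (w z : R) (A : set (configs R)) : Q.-negligible A ->
  (forall c, typical c -> pair_start c -> unhit w z (shift 2 c) -> A c) ->
  Q (unhit w z) = 0%E.
Proof.
move=> nA h; have mz := measurable_unhit w z.
have mS := measurable_shift_preimage 2 mz.
have : Q (pair_start `&` shift 2 @^-1` unhit w z) = 0%E.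
  apply: negligible_eq0; first exact: (measurableI _ _ past_pair_start.1 mS).
  apply: negligibleS (negligibleU nA not_typical) => c [pc uc].
  by have [tc|] := pselect (typical c); [left; exact: h|right].
rewrite (past_independent Q_box past_pair_start mz) => /eqP.
by rewrite mule_eq0 (gt_eqF pair_start_gt0) => /eqP.
Qed.

Lemma unhit_negligible (w : R) : lo <= w -> Q (ghost w) = 0%E ->
  forall k : nat, Q (unhit w (k.+1%:R * delta)) = 0%E.
Proof.
move=> low Qw; have w0 : 0 <= w by apply: le_trans low; exact/ltW/V_gt0.
elim=> [|k IH].
  apply: (pair_transfer (negligible_measurable (measurable_ghost w) Qw)) => c tc pc.
  have [_ gc] := tc.
  rewrite mul1r unhit_nohit//; last exact: good_shift.
  move=> h; apply/ghost_nohit => //; have [_ d _] := gc; have d0 := d 0%N.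
  by apply: (pair_unhit low _ _ _ tc pc h) => //; rewrite ?lerDr ltW.
have y0 : 0 < k.+1%:R * delta by rewrite mulr_gt0.
apply: (pair_transfer (negligible_measurable (measurable_unhit w _) IH)) => c tc pc.
have [_ gc] := tc.
rewrite unhit_nohit//; [|by rewrite mulr_gt0|exact: good_shift].
move=> h; apply/unhit_nohit => //.
apply: (pair_unhit low _ _ _ tc pc h) => //; first by rewrite mulr_ge0// ltW.
by rewrite -(natr1 k.+1) mulrDl mul1r.
Qed.

End pairs.

Lemma ghost_fastest_gt0 hi : V hi -> (forall x, V x -> x <= hi) ->
  (0 < Q (ghost hi))%E.
Proof.
move=> Vhi le_hi; rewrite lt0e measure_ge0 andbT; apply/eqP => Q0.
have : Q.-negligible (setT : set (configs R)).
  have n1 := negligible_measurable (measurable_ghost hi) Q0.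
  apply: negligibleS (negligibleU n1 not_typical) => c _.
  have [[cV gc]|] := pselect (typical c); last by right.
  left; apply/ghost_nohit => //; first exact/ltW/V_gt0.
  apply: nohit_fastest; [exact: good_regular|exact: V_gt0| |].
    by have [_ d _] := gc; exact: d.
  by move=> i; exact/le_hi/cV.
move=> /(negligible_eq0 measurableT) QT.
by have /eqP := etrans (esym (probability_setT Q)) QT; rewrite onee_eq0.
Qed.

Section critical.
Variables (lo hi s : R).
Hypotheses (Vlo : V lo) (Vhi : V hi) (Vs : V s).
Hypotheses (ge_lo : forall x, V x -> lo <= x) (le_hi : forall x, V x -> x <= hi).
Hypothesis Qs : (0 < Q (ghost s))%E.
Hypothesis s_min : forall x, V x -> (0 < Q (ghost x))%E -> s <= x.

Lemma ghost_slow x : V x -> x < s -> Q (ghost x) = 0%E.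
Proof.
move=> Vx xs; apply/eqP; rewrite eq_le measure_ge0 andbT leNgt; apply/negP.
by move=> /(s_min Vx); rewrite leNgt xs.
Qed.

(** A survivor of velocity x is a ghost of velocity x for the bullets after it, and
    theta x = 0 for the finitely many x < s in V. *)
Lemma slow_survivors_negligible :
  Q.-negligible [set c | typical c /\ exists2 i, immortal c setT i & (c i).1 < s].
Proof.
pose B n : set (configs R) := if (n < size vs)%N && (vs`_n < s) then ghost vs`_n else set0.
have nB n : Q.-negligible (B n).
  rewrite /B; case: ifPn => [/andP[ns xs]|_]; last exact: negligible_set0.
  apply: negligible_measurable; first exact: measurable_ghost.
  by apply: ghost_slow => //=; exact: mem_nth.
apply: (@negligibleS _ _ _ _
  (\bigcup_i (shift i @^-1` (shift 1 @^-1` (\bigcup_n B n)) : set (configs R)))).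
  move=> c [[cV gc] [i im slow]]; exists i => //.
  have imi : immortal (shift i c) setT 0.
    apply/(immortal_shift _ _ (good_regular gc)); rewrite addn0.
    exact: immortal_from (good_regular gc) im.
  move: imi => /(ghost_first (good_shift i gc)); rewrite /shift addn0 => gi.
  exists (index (c i).1 vs) => //; rewrite /B.
  have cvs : (c i).1 \in vs by exact: cV.
  by rewrite index_mem cvs nth_index// slow.
apply: negligible_bigcup => i.
do 2 apply: (negligible_shift Q_box).
exact: negligible_bigcup.
Qed.

(** In a clear configuration a next bullet of velocity s is not going to hit anything
    in front of it. When s is the least velocity this needs no condition. *)
Definition clear (n : nat) : set (configs R) :=
  [set c | s = lo] `|` (forever (upto n) n `&` [set c | s <= (c n).1]).

Lemma past_clear n : past n (clear n).
Proof.
split.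
  apply: measurableU; first exact: measurable_set_cst.
  apply: measurableI; first exact: measurable_forever.
  by apply: measurable_set_le; [exact: measurable_cst|exact: measurable_velocity].
move=> c c' cc [slo|[im sv]]; [by left|right].
have fE i : (i <= n)%N -> fire_time c i = fire_time c' i.
  move=> i_n; apply: eq_big_nat => j /andP[_]; rewrite ltnS => ji.
  by rewrite cc//; exact: leq_trans ji i_n.
split; last by rewrite /= -cc.
move=> k; rewrite -fE//; apply/(life_congr (b := c)); last exact: im.
by move=> i i_n; rewrite fE// cc.
Qed.

(** Read after a clear index n: bullet n + 1 has velocity s and is not hit from
    behind. *)
Definition launch : set (configs R) :=
  [set c | (c 0%N).1 = s] `&` shift 1 @^-1` (ghost s).

Lemma measurable_launch : measurable launch.
Proof.
apply: measurableI.
  by apply: measurable_set_eq; [exact: measurable_velocity|exact: measurable_cst].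
by apply: measurable_shift_preimage; exact: measurable_ghost.
Qed.

(** The velocity of the first bullet is independent of the fate of the ghost. *)
Lemma launch_gt0 : (0 < Q launch)%E.
Proof.
have ms : measurable [set p : E | p.1 = s].
  by apply: measurable_set_eq; [exact: measurable_fst|exact: measurable_cst].
have p0 : past 0 [set c : configs R | (c 0%N).1 = s].
  split; first by apply: measurable_set_eq; [exact: measurable_velocity|exact: measurable_cst].
  by move=> c c' cc /=; rewrite cc.
rewrite (past_independent Q_box p0 (measurable_ghost s)) mule_gt0//.
have -> : Q [set c : configs R | (c 0%N).1 = s] = rho [set p | p.1 = s].
  exact: (Q_first Q_box ms).
have [delta _ long] := exists_long_delay rho_delay.
apply: lt_le_trans (rho_atom Vs long) _; apply: le_measure; rewrite ?inE//.
  exact: measurable_atom.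
by move=> p [].
Qed.

Lemma clear_launch n c : typical c -> clear n c -> launch (shift n.+1 c) ->
  immortal c setT n.+1 /\ (c n.+1).1 = s.
Proof.
move=> [cV gc] cl [v0 gh]; have rc := good_regular gc.
have vn : (c n.+1).1 = s by move: v0; rewrite /= /shift addn0.
split => //; apply: (immortal_glue rc).
  case: cl => [slo|[fn sv]].
    by apply: immortal_slowest => // i; rewrite vn slo; exact/ge_lo/cV.
  apply: immortal_slower => //; last by rewrite vn.
  by apply/foreverE => //; exact: leqnn.
have := ghost_first (good_shift n.+1 gc); rewrite v0 => -[/(_ gh) + _].
by move=> /(immortal_shift _ _ rc); rewrite addn0.
Qed.

Definition often (A : nat -> Prop) := forall N : nat, exists2 n, (N <= n)%N & A n.

(** If no s-bullet of index at least k survived, all launches from clear indices would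
    fail, which [trials] excludes. *)
Lemma clear_often_negligible : Q.-negligible [set c | typical c /\
  (often (fun n => clear n c) /\
   ~ often (fun n => immortal c setT n /\ (c n).1 = s))].
Proof.
pose I k : set (configs R) := typical `&`
  ([set c | forall N, exists n, (N <= n)%N /\ clear n c] `&`
   [set c | forall n, (k <= n)%N -> ~ ((c n).1 = s /\ forever setT n c)]).
apply: (@negligibleS _ _ _ _ (\bigcup_k I k)).
  move=> c [tc [cl /existsNP[k hk]]]; exists k => //; split => //; split.
    by move=> N; have [n Nn cn] := cl N; exists n.
  move=> n kn [vn fn]; apply: hk; exists n => //; split => //.
  by apply/foreverE => //; exact: good_regular tc.2.
apply: negligible_bigcup => k; have mI : measurable (I k).
  apply: (measurableI _ _ m_typical); apply: measurableI.
    apply: (measurable_set_forall (A := fun N => [set c | exists n, (N <= n)%N /\ clear n c])) => N.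
    apply: (measurable_set_exists (A := fun n => [set c | (N <= n)%N] `&` clear n)) => n.
    by apply: measurableI; [exact: measurable_set_cst|exact: (past_clear n).1].
  apply: (measurable_set_forall (A := fun n => [set c : configs R | (k <= n)%N -> ~ ((c n).1 = s /\ forever setT n c)])) => n.
  apply: measurable_set_imply; first exact: measurable_set_cst.
  apply: (@measurableC _ _ ([set c : configs R | (c n).1 = s] `&` forever setT n)).
  apply: measurableI; last exact: measurable_forever.
  by apply: measurable_set_eq; [exact: measurable_velocity|exact: measurable_cst].
apply: negligible_measurable => //.
apply: (trials Q_box past_clear measurable_launch launch_gt0 mI (k := k)).
  by move=> c [_ [h _]] N; have [n [Nn cn]] := h N; exists n.
move=> n c kn [tc [_ nos]] cn ln; have [im vn] := clear_launch tc cn ln.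
apply: (nos n.+1); first exact: leqW.
by split => //; apply/foreverE => //; exact: good_regular tc.2.
Qed.

(** The lines have as velocity w the element of V just below s, so that a bullet faster
    than w has velocity at least s. *)
Lemma clear_or_survivor_negligible : Q.-negligible [set c | typical c /\
  (~ often (fun n => clear n c) /\
   forall j, immortal c setT j -> (c j).1 < s)].
Proof.
have [slo|slo] := eqVneq s lo.
  apply: negligibleS (negligible_set0 Q) => c [_ [nof _]]; apply: nof => N.
  by exists N => //; left.
have lo_s : lo < s by rewrite lt_neqAle eq_sym slo ge_lo.
have [|w [wvs ws wmax]] := @seq_max R vs (fun x => x < s); first by exists lo.
have [delta d0 long] := exists_long_delay rho_delay.
have lohi : lo < hi by apply: lt_le_trans lo_s _; exact: le_hi.
have Qw := ghost_slow wvs ws.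
have low : lo <= w by exact: ge_lo.
have Qu := unhit_negligible Vlo Vhi lohi le_hi d0 long low Qw.
have nU k := negligible_measurable (measurable_unhit w (k.+1%:R * delta)) (Qu k).
apply: negligibleS (negligible_bigcup nU) => c [tc [nof slow]].
apply: contrapT => nu; apply: nof => N; have [cV gc] := tc.
have w0 : 0 < w by exact: V_gt0.
have [|k|j im|n [Nn im vn]] := late_hitters (good_regular gc) w0 (V_gt0 Vhi) d0 _ _ _ N.
- by move=> i; exact/le_hi/cV.
- move=> nh; apply: nu; exists k => //; apply/unhit_nohit => //; first exact: ltW.
  by rewrite mulr_gt0.
- by apply: wmax; [exact: cV|exact: slow].
exists n => //; right; split.
  by apply/foreverE => //; [exact: good_regular|exact: leqnn].
rewrite /= leNgt; apply/negP => sn; move: vn; rewrite ltNge wmax//.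
exact: cV.
Qed.

(** The exceptional event is enlarged to all shifts of the sequence, because the
    survivors are found one after the other, each one in the sequence restarted just
    after the previous one. *)
Theorem survivors_almost_surely : Q.-negligible (~` [set c | typical c /\
  [/\ often (fun n => immortal c setT n /\ (c n).1 = s) &
      exists K, forall j, immortal c setT j -> (c j).1 <> s -> (j < K)%N]]).
Proof.
pose Bad := ~` typical `|` ([set c | typical c /\ exists2 i, immortal c setT i & (c i).1 < s] `|`
  ([set c | typical c /\ (often (fun n => clear n c) /\
   ~ often (fun n => immortal c setT n /\ (c n).1 = s))] `|`
   [set c | typical c /\ (~ often (fun n => clear n c) /\
   forall j, immortal c setT j -> (c j).1 < s)])).
have nBad : Q.-negligible Bad.
  apply: negligibleU not_typical (negligibleU slow_survivors_negligible
   (negligibleU clear_often_negligible clear_or_survivor_negligible)).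
have nShift m := negligible_shift Q_box m nBad.
apply: negligibleS (negligible_bigcup nShift) => c; apply: contra_notP => h.
have {}h m : ~ Bad (shift m c) by move=> Bm; apply: h; exists m.
have tc : typical c by apply: contrapT => nt; apply: (h 0%N); left.
have gc := tc.2; have rc := good_regular gc.
have ex m : exists2 j, immortal (shift m c) setT j & s <= (shift m c j).1.
  have tm := typical_shift m tc; apply: contrapT => nex.
  have nolarge j : immortal (shift m c) setT j -> (shift m c j).1 < s.
    by move=> im; rewrite ltNge; apply/negP => sj; apply: nex; exists j.
  (* Infinitely many clear indices give survivors by launching, and finitely many
     leave a survivor by the hitting argument. *)
  have [cl|ncl] := pselect (often (fun n => clear n (shift m c))); last first.
    by apply: (h m); right; right; right.
  have [so|nso] := pselect (often (fun n => immortal (shift m c) setT n /\ (shift m c n).1 = s)).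
    by have [n _ [im vn]] := so 0%N; apply: nex; exists n => //; rewrite vn.
  by apply: (h m); right; right; left.
have fast : often (fun n => immortal c setT n /\ s <= (c n).1).
  elim=> [|N [n Nn [im vn]]].
    by have [j im vj] := ex 0%N; exists j.
  have [j jm vj] := ex n.+1; exists (n.+1 + j)%N.
    by apply: (leq_trans _ (leq_addr _ _)); rewrite ltnS.
  split => //; apply: (immortal_behind rc im).
  exact/(immortal_shift _ _ rc).
have cl : often (fun n => clear n c).
  move=> N; have [n Nn [im vn]] := fast N; exists n => //; right; split => //.
  by apply/foreverE => //; [exact: leqnn|exact: immortal_upto].
have so : often (fun n => immortal c setT n /\ (c n).1 = s).
  by apply: contrapT => nso; apply: (h 0%N); right; right; left.
split => //; split => //.
have [i _ [im vi]] := so 0%N; exists i.+1 => j jm vj; rewrite ltnS leqNgt; apply/negP => ij.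
apply: vj; apply: le_anti; apply/andP; split.
  by rewrite -vi; exact: immortal_velocity ij.
rewrite leNgt; apply/negP => sl; apply: (h 0%N); right; left; split => //.
by exists j.
Qed.

(** An s-survivor catches up with every slower ghost. *)
Lemma ghost_below w : 0 <= w -> w < s -> Q (ghost w) = 0%E.
Proof.
move=> w0 ws; apply: negligible_eq0; first exact: measurable_ghost.
apply: negligibleS survivors_almost_surely => c gh [[cV gc] [so _]].
have [i _ [im vi]] := so 0%N.
apply: (hit_of_immortal (good_regular gc) w0 _ _ im); last exact/ghost_nohit.
  by have [_ d _] := gc; exact/ltW.
by rewrite vi.
Qed.

End critical.

End core.

(** * The support of the velocity law *)

Section support.
Context {R : realType} (mu : probability (measurableTypeR R) R).

(** A point outside the support lies in a null interval with rational endpoints, and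
    there are countably many of these. *)
Lemma negligible_outside_support : mu.-negligible (~` msupport mu).
Proof.
pose F (n : nat) : set (measurableTypeR R) := if unpickle n is Some (p, q) then
  (if mu `]ratr p : R, ratr q : R[%classic == 0%E then `]ratr p : R, ratr q : R[%classic else set0)
  else set0.
apply: (@negligibleS _ _ _ _ (\bigcup_n F n)).
  move=> x /existsNP[U /not_implyP[oU /not_implyP[Ux /negP]]].
  rewrite -leNgt => U0.
  have mU0 : mu U = 0%E by apply/eqP; rewrite eq_le U0 measure_ge0.
  have /nbhs_ballP[e /= e0 eU] : nbhs x U by exact: open_nbhs_nbhs.
  have x_e : x - e < x by rewrite ltrBlDr ltrDl.
  have xe : x < x + e by rewrite ltrDl.
  have [p /itvP hp] := rat_in_itvoo x_e; have [q /itvP hq] := rat_in_itvoo xe.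
  exists (pickle (p, q)); first exact: I.
  rewrite /F pickleK.
  have pqU : `]ratr p : R, ratr q : R[%classic `<=` U.
    move=> y /=; rewrite in_itv/= => /andP[py yq]; apply: eU.
    have xp : x - e < ratr p by rewrite hp.
    have qx : ratr q < x + e by rewrite hq.
    rewrite /ball /= ltr_norml.
  apply/andP; split.
    by rewrite ltrNl opprB ltrBlDr addrC; apply: (lt_trans yq).
  by rewrite ltrBlDr -ltrBlDl; apply: lt_trans py.

  have -> : mu `]ratr p : R, ratr q : R[%classic == 0%E.
    rewrite eq_le measure_ge0 andbT; apply: (le_trans _ U0).
    apply: le_measure; [| |exact: pqU]; rewrite inE.
      exact: measurable_itv.
    exact: open_measurable.
  by rewrite /= in_itv/= hp hq.
apply: negligible_bigcup => n; rewrite /F.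
case: (unpickle n) => [[p q]|]; last exact: negligible_set0.
case: ifPn => [/eqP m0|_]; last exact: negligible_set0.
by apply/negligibleP => //; exact: measurable_itv.
Qed.

(** A point of a finite support is isolated in it. *)
Lemma support_atom (s : R) : finite_set (msupport mu) -> msupport mu s ->
  (0 < mu [set s])%E.
Proof.
move=> fin ss; rewrite lt0e measure_ge0 andbT; apply/eqP => m0.
pose U := ~` (msupport mu `\ s).
have oU : open U.
  apply: closed_openC; apply: (accessible_finite_set_closed.1) => //.
    by apply: hausdorff_accessible; exact: norm_hausdorff.
  exact: finite_setD.
have : (0 < mu U)%E by apply: ss => // -[_]; apply.
suff -> : mu U = 0%E by rewrite ltxx.
have mU : measurable (U : set (measurableTypeR R)) by exact: open_measurable.
apply/negligibleP => //.
have ns : mu.-negligible [set s] by apply/negligibleP.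
apply: negligibleS (negligibleU ns negligible_outside_support) => x nx.
have [->|xs] := eqVneq x s; first by left.
by right=> sx; apply: nx; split => // /= xse; rewrite xse eqxx in xs.
Qed.

End support.

(** * From the law of the sequence back to the probability space *)

Section transfer.
Context {R : realType}.
Local Notation E := (measurableTypeR R * measurableTypeR R)%type.
Variables (mu nu : probability (measurableTypeR R) R).
Context (d : measure_display) (T : measurableType d) (P : probability T R).
Variable X : nat -> {RV P >-> E}.
Hypothesis X_iid : iid_bullets mu nu X.

Lemma measurable_config : measurable_fun setT (config X : T -> configs R).
Proof. by apply: measurable_to_configs => i; exact: measurable_funPT. Qed.

Definition law : probability (configs R) R :=
  distribution P (mfun_Sub (mem_set measurable_config)).

Lemma lawE (A : set (configs R)) : law A = P (config X @^-1` A).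
Proof. by []. Qed.

Lemma law_box U n : (forall i, measurable (U i)) ->
  law (box U n) = (\prod_(i < n) (mu \x nu) (U i))%E.
Proof.
move=> mU; rewrite lawE; have [ind dist] := X_iid.
have -> : config X @^-1` box U n = \big[setI/setT]_(i <- iota 0 n) (X i @^-1` U i).
  rewrite -bigcap_seq; apply/seteqP; split => x h i /=.
    by rewrite mem_iota => /andP[_ i_n]; exact: h.
  by move=> i_n; apply: (h i); rewrite /= mem_iota.
rewrite ind ?iota_uniq// -(big_mkord xpredT (fun i => (mu \x nu)%E (U i))) /index_iota subn0.
by apply: eq_bigr => i _; rewrite -(dist i)//.
Qed.

Lemma negligible_law (A : set (configs R)) : law.-negligible A ->
  P.-negligible (config X @^-1` A).
Proof.
move=> [B [mB QB AB]]; exists (config X @^-1` B); split.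
- by rewrite -[X in measurable X]setTI; exact: measurable_config.
- exact: QB.
- by move=> x; exact: AB.
Qed.

Variable V : set R.
Let tp := @typical R V.
Hypothesis mtp : measurable tp.
Hypothesis ntp : law.-negligible (~` tp).

Lemma survives_ghost (w : R) (x : T) : 0 <= w -> tp (config X x) ->
  survives (set_velocity0 (config X x) w) 0 <-> ghost w (shift 1 (config X x)).
Proof.
move=> w0 [_ gc]; rewrite (ghostE (good_regular gc) w0).
by rewrite (ghost_nohit w0 (good_shift 1 gc)).
Qed.

(** The outer measure does not see the null set of configurations where the process
    is not well defined. *)
Lemma theta_eq0 (w : R) : 0 <= w -> law (ghost w) = 0%E -> theta X w = 0%E.
Proof.
move=> w0 Q0.
have n1 : law.-negligible (shift 1 @^-1` ghost w : set (configs R)).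
  apply: (negligible_shift law_box).
  exact: negligible_measurable (measurable_ghost w) Q0.
have [B [mB PB sB]] := negligible_law (negligibleU ntp n1).
apply/eqP; rewrite eq_le; apply/andP; split; last exact: mu_ext_ge0.
rewrite -PB -(measurable_mu_extE P mB); apply: le_mu_ext => x sx; apply: sB.
have [tx|] := pselect (tp (config X x)); last by left.
by right; apply/survives_ghost.
Qed.

Lemma theta_gt0 (w : R) : 0 <= w -> (0 < law (ghost w))%E -> (0 < theta X w)%E.
Proof.
move=> w0 Q0; pose A : set (configs R) := tp `&` shift 1 @^-1` ghost w.
have mA : measurable A.
  by apply: measurableI => //; apply: measurable_shift_preimage; exact: measurable_ghost.
have PA : (0 < law A)%E.
  rewrite lt0e measure_ge0 andbT; apply/eqP => A0.
  have : law.-negligible (shift 1 @^-1` ghost w : set (configs R)).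
    apply: negligibleS (negligibleU ntp (negligible_measurable mA A0)) => c gc.
    by have [tc|] := pselect (tp c); [right|left].
  move=> /(negligible_eq0 (measurable_shift_preimage 1 (measurable_ghost w))).
  move=> /(etrans (esym (shift_law law_box 1 (measurable_ghost w)))) g0.
  by move: Q0; rewrite g0 ltxx.
apply: lt_le_trans PA _; rewrite lawE.
have mPA : measurable (config X @^-1` A).
  by rewrite -[X in measurable X]setTI; exact: measurable_config.
rewrite -(measurable_mu_extE P mPA); apply: le_mu_ext => x [tx gx].
exact/survives_ghost.
Qed.

End transfer.

Lemma often_infinite (A : nat -> Prop) : often A -> infinite_set [set n | A n].
Proof.
move=> oA /finite_seqP[s As].
have [n sn An] := oA (\max_(i <- s) i).+1.
have ns : n \in s by have : [set` s] n by rewrite -As.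
suff : (n <= \max_(i <- s) i)%N by rewrite leqNgt sn.
exact: leq_bigmax_seq.
Qed.

Section one_bullet.
Context {R : realType} (mu nu : probability (measurableTypeR R) R).
Local Notation E := (measurableTypeR R * measurableTypeR R)%type.
Hypothesis mu_pos : mu [set x : R | 0 < x] = 1%E.
Hypothesis nu_pos : nu [set x : R | 0 < x] = 1%E.
Variable vs : seq R.
Local Notation V := [set` vs].
Hypothesis support_mu : msupport mu = V.

Let mV : measurable (V : set (measurableTypeR R)).
Proof. exact: measurable_speeds. Qed.

Lemma measurable_gt (x : R) : measurable [set y : measurableTypeR R | x < y].
Proof. by apply: measurable_set_lt; [exact: measurable_cst|exact: measurable_id]. Qed.

Lemma mu_support : mu V = 1%E.
Proof.
have nV : mu (~` V) = 0%E.
  apply/negligibleP; first exact: measurableC.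
  by rewrite -support_mu; exact: negligible_outside_support.
have := probability_setC mu (measurableC mV); rewrite setCK nV sube0; exact.
Qed.

Lemma mu_atom s : V s -> (0 < mu [set s])%E.
Proof.
move=> Vs; apply: support_atom; last by rewrite support_mu.
by rewrite support_mu; apply/finite_seqP; exists vs.
Qed.

Lemma support_gt0 s : V s -> 0 < s.
Proof.
move=> Vs; rewrite ltNge; apply/negP => s0.
have := mu_atom Vs; suff -> : mu [set s] = 0%E by rewrite ltxx.
apply/negligibleP; first exact: measurable_set1.
apply: negligibleS (negligible_setC (measurable_gt 0) mu_pos) => x /= ->.
by rewrite ltNge s0.
Qed.

Lemma support_neq0 : exists s, s \in vs.
Proof.
case: vs mu_support => [|s l] e; last by exists s; rewrite mem_head.
have : mu [set` [::] : seq R] = 0%E by rewrite set_nil measure0.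
by move=> /(etrans (esym e)) /eqP; rewrite onee_eq0.
Qed.

Lemma bullet_speed : (mu \x nu)%E [set p : E | V p.1] = 1%E.
Proof.
have -> : [set p : E | V p.1] = V `*` setT by apply/seteqP; split => p //= [].
transitivity (mu V * nu setT)%E; first exact: product_measure1E.
by rewrite mu_support probability_setT mule1.
Qed.

Lemma bullet_delay (x : R) : (mu \x nu)%E [set p : E | x < p.2] = nu [set y | x < y].
Proof.
have -> : [set p : E | x < p.2] = setT `*` [set y | x < y].
  by apply/seteqP; split => p //= [].
transitivity (mu setT * nu [set y | (x < y)%R])%E.
  by apply: product_measure1E => //; exact: measurable_gt.
by rewrite probability_setT mul1e.
Qed.

Lemma bullet_atom (s delta : R) : V s ->
  (0 < (mu \x nu)%E [set p : E | (delta < p.2)%R])%E ->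
  (0 < (mu \x nu)%E [set p : E | p.1 = s /\ (delta < p.2)%R])%E.
Proof.
move=> Vs; rewrite bullet_delay => nd.
have -> : [set p : E | p.1 = s /\ (delta < p.2)%R] = [set s] `*` [set y | delta < y] by [].
have -> : (mu \x nu)%E ([set s] `*` [set y | delta < y]) =
    (mu [set s] * nu [set y | (delta < y)%R])%E.
  by apply: product_measure1E; [exact: measurable_set1|exact: measurable_gt].
by rewrite mule_gt0// mu_atom.
Qed.

End one_bullet.

Theorem theorem3 (R : realType) (mu nu : probability (measurableTypeR R) R)
    (mu_pos : mu [set x : R | 0 < x] = 1%E) (nu_pos : nu [set x : R | 0 < x] = 1%E)
    (mu_fin : finite_set (msupport mu))
    (d : measure_display) (T : measurableType d) (P : probability T R)
    (X : nat -> {RV P >-> (measurableTypeR R * measurableTypeR R)%type})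
    (X_iid : iid_bullets mu nu X) (X_valid : valid X) :
  {ae P, forall x,
    infinite_set [set i | survives (config X x) i] /\
    finite_set [set i | survives (config X x) i /\
                        ((config X x i).1)%:E <> critical_velocity X]}.
Proof.
move/finite_seqP: mu_fin => [vs suppE].
pose rho : probability (measurableTypeR R * measurableTypeR R)%type R := (mu \x nu)%E.
have V_gt0 := support_gt0 mu_pos suppE.
have speed : rho [set p | [set` vs] p.1] = 1%E := bullet_speed nu suppE.
have delay : rho [set p | 0 < p.2] = 1%E := etrans (bullet_delay mu nu 0) nu_pos.
have atom s delta : [set` vs] s -> (0 < rho [set p | (delta < p.2)%R])%E ->
    (0 < rho [set p | p.1 = s /\ (delta < p.2)%R])%E := @bullet_atom _ mu nu vs suppE s delta.
have [v0 v0s] := support_neq0 suppE.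
have [|lo [Vlo _ ge_lo]] := @seq_min R vs (fun=> True); first by exists v0.
have [|hi [Vhi _ le_hi]] := @seq_max R vs (fun=> True); first by exists v0.
pose Q := law X; have Qbox := law_box X_iid.
have hi_max x : [set` vs] x -> x <= hi by move=> ?; exact: le_hi.
have Qhi := ghost_fastest_gt0 Qbox speed V_gt0 delay Vhi hi_max.
(* The velocity that will turn out to be critical. *)
have [|s [Vs Qs s_min]] := @seq_min R vs (fun x => (0 < Q (ghost x))%E).
  by exists hi.
have s0 : 0 < s by exact: V_gt0.
have lo_min x : [set` vs] x -> lo <= x by move=> ?; exact: ge_lo.
have s_least x : [set` vs] x -> (0 < Q (ghost x))%E -> s <= x by exact: s_min.
have main := survivors_almost_surely Qbox speed V_gt0 delay atom Vlo Vhi Vs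
  lo_min hi_max Qs s_least.
have below := ghost_below Qbox speed V_gt0 delay atom Vlo Vhi Vs
  lo_min hi_max Qs s_least.
have mtp := measurable_typical (measurable_speeds vs) V_gt0.
have ntp := negligible_not_typical Qbox (measurable_speeds vs) speed V_gt0 delay.
have vc : critical_velocity X = s%:E.
  apply/eqP; rewrite eq_le; apply/andP; split.
    apply: ereal_inf_lbound; exists s => //; split; first exact: ltW.
    by apply: (theta_gt0 X_iid mtp ntp) => //; exact: ltW.
  apply: le_ereal_inf_tmp => _ [w [w0 tw] <-]; rewrite lee_fin leNgt.
  apply/negP => ws; move: tw; rewrite (theta_eq0 X_iid ntp w0) ?ltxx//.
  exact: below.
apply: negligibleS (negligible_law main) => x; apply: contra_not => -[[_ gc] [so [K hK]]].
have rc := good_regular gc; split.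
  apply: sub_infinite_set (often_infinite so) => i [im _]; exact/survivesE.
apply: (sub_finite_set _ (finite_II K)) => i [/(survivesE _ rc) im ne] /=.
by apply: hK => // vi; apply: ne; rewrite vc -vi.
Qed.
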